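(* Let $R>0$, $M>0$, $q$ be such that $0\le qR\le 1$ and $2M\ge qR^2$. Then there exists a unique $a_M\in(0,R)$ such that $\varphi(a_M)=M$, and there exists a unique $a_*\in[a_M,R)$ such that $\zeta_q(a_* )=M$. Moreover, there exists a unique solution to the problem $$\min\Big\{\int_0^R\frac{r\,dr}{1+u'(r)^2}\;:\;u\in\mathcal R_{R;M;q}\Big\},$$ and it is given by $$u(r)=\begin{cases}\dfrac q2\,(r^2-a_*^2)+M & \text{if } r\in[0,a_*],\\[2mm] -\displaystyle\int_r^R h^{-1}\!\left(\frac{a_*\,h(-\gamma_q(a_* ))}{s}\right)ds & \text{if } r\in(a_*,R].\end{cases}$$
   Context: For $R>0$, $M>0$, $q\ge0$, $\mathcal R_{R;M;q}$ is the set of functions $u:[0,R]\to[0,M]$ such that $r\mapsto u(r)-\frac q2r^2$ is nonincreasing and concave on $[0,R]$; $u'$ denotes the a.e. derivative. Let $h:(-\infty,-1]\to\mathbb R$, $h(t)=-t(1+t^2)^{-2}$; it is strictly increasing with range $(0,\frac14]$, and $h^{-1}:(0,\frac14]\to(-\infty,-1]$ denotes its inverse. For $a\in(0,R)$ define $$\varphi(a)=-\int_a^R h^{-1}\!\left(\frac{a}{4r}\right)dr,\qquad \gamma_q(a)=\sqrt{\tfrac12\Big(3a^2q^2+1+\sqrt{9a^4q^4+10a^2q^2+1}\Big)},$$ $$\zeta_q(a)=-\int_a^R h^{-1}\!\left(\frac{a\,h(-\gamma_q(a))}{r}\right)dr.$$ *)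

(* Defs.v *)
From HB Require Import structures.
From mathcomp Require Import all_boot all_order all_algebra.
From mathcomp Require Import all_classical all_reals all_analysis.
Import Order.TTheory GRing.Theory Num.Theory.
Import numFieldNormedType.Exports.

Set Implicit Arguments.
Unset Strict Implicit.
Unset Printing Implicit Defensive.

Local Open Scope classical_set_scope.
Local Open Scope ring_scope.
Local Open Scope convex_scope.

Definition concave_function (K : realType) (D : set K) (f : K -> K) : Prop :=
  forall t : {i01 K}, {in D &, forall x y : K,
    (f x : K^o) <| t |> (f y : K^o)
      <= f ((x : convex_lmodType K^o) <| t |> (y : convex_lmodType K^o))}.

(* A profile [0, R] -> [0, M] is represented by a function on the whole line of
   which only the values on [0, R] matter. *)
Definition profiles (K : realType) (R M q : K) : set (K -> K) :=
  [set u | [/\ forall r : K, r \in `[0, R] -> u r \in `[0, M],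
               {in `[0, R] &, nonincreasing_fun (fun r => u r - q / 2 * r ^+ 2)}
             & concave_function `[0, R] (fun r => u r - q / 2 * r ^+ 2)]].

(* [derive1 u r] is the derivative of [u] at [r] wherever [u] is derivable.  For
   a profile the exceptional points of [0, R] form a countable set, so that the
   values of [derive1 u] there do not affect the integral. *)
Definition resistance (K : realType) (R : K) (u : K -> K) : \bar K :=
  \int[lebesgue_measure]_(r in `[0, R]) (r / (1 + (derive1 u r) ^+ 2))%:E.

Definition is_minimizer (K : realType) (R M q : K) (u : K -> K) : Prop :=
  profiles R M q u /\
  forall v, profiles R M q v -> (resistance R u <= resistance R v)%E.

Definition h (K : realType) (t : K) : K := - t * (1 + t ^+ 2) ^- 2.

(* Inverse of the restriction of [h] to ]-oo, -1]; the default value -1 is only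
   taken outside the range ]0, 1/4] of this restriction. *)
Definition hinv (K : realType) : K -> K :=
  'pinv_(fun=> -1) `]-oo, -1] (@h K).

Definition phi (K : realType) (R a : K) : K :=
  - \int[lebesgue_measure]_(r in `[a, R]) hinv (a / (4 * r)).

Definition gamma (K : realType) (q a : K) : K :=
  Num.sqrt (2^-1 * (3 * a ^+ 2 * q ^+ 2 + 1
    + Num.sqrt (9 * a ^+ 4 * q ^+ 4 + 10 * a ^+ 2 * q ^+ 2 + 1))).

Definition zeta (K : realType) (R q a : K) : K :=
  - \int[lebesgue_measure]_(r in `[a, R]) hinv (a * h (- gamma q a) / r).

Definition optimal_profile (K : realType) (R M q a : K) (r : K) : K :=
  if r <= a then q / 2 * (r ^+ 2 - a ^+ 2) + M
  else - \int[lebesgue_measure]_(s in `[r, R]) hinv (a * h (- gamma q a) / s).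

(* Main.v *)
Require Import Defs.
From mathcomp Require Import all_boot all_order all_algebra.
From mathcomp Require Import all_classical all_reals all_analysis.
From mathcomp Require Import measurable_realfun ring lra.
Import Order.TTheory GRing.Theory Num.Theory.
Import numFieldNormedType.Exports.

Local Open Scope classical_set_scope.
Local Open Scope ring_scope.

Set Implicit Arguments.
Unset Strict Implicit.
Unset Printing Implicit Defensive.

(* Let v be a profile and m the nondecreasing function with v' = q r - m, and let
   x be the point where v' becomes negative.  On [0, x] pairing r with x - r
   shows that m = 0 is optimal.  On [x, R] one has p = -v' >= 0, and weak duality
   for the constraint that the integral of p is at most M, with the pointwise
   minimum [lag k r] of r / (1 + p^2) + 2 k p, bounds the resistance from below by
   [dual_bound x k] for every multiplier k > 0.  Write k(r) = r h(-gamma_q(r));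
   then [lag (k r) r] is the drag r / (1 + (q r)^2) of the parabola at r, and
   zeta_q(a) is the drop of the profile of slope [slope (k a)] on [a, R].
   Take for k the running minimum of k(.) on [a_*, x], or its running maximum on
   [x, a_*]: then the derivative of [dual_bound x k] in x, which is
   lag (k x) x - lag k x, has the sign of x - a_*, while k changes only at points
   where k = k(x), where the derivative in k is 2 (zeta_q(x) - M).  Since zeta_q
   decreases strictly and equals M at a_*, the bound is minimal at x = a_*.  There
   it is attained, and the equality cases give uniqueness. *)

(** The factor in 2 k makes stationarity of r / (1 + p^2) + 2 k p read k = r h(-p). The slope
    gamma_q(r) comes from asking for which k the parabola and the Lagrangian minimum cost the same
    at r: for that k the tangent to 1 / (1 + p^2) at gamma_q(r) meets the axis p = 0 at the height 1
    / (1 + (q r)^2). The obstacle is that the turning point x of a competitor is unknown. But k(.)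
    need not be monotone when q r is close to 1, so the multiplier has to move with x; a running
    extremum moves it only in the direction that the sign of zeta_q(x) - M makes favourable. Running
    extrema need not be differentiable in x, so derivatives are replaced by increments over [y, z],
    with an error that is z - y times an increment of a monotone function; such errors telescope
    away. *)

(* On a uniform partition of [a, b] into n steps the increments of g telescope, so
   that f a - f b = O(1/n); neither f nor g need be continuous. *)
Lemma le_telescoping (K : realType) (a b C : K) (f g : K -> K) : a <= b ->
  (forall y z, a <= y -> y <= z -> z <= b ->
     f y - f z <= C * (z - y) * (g z - g y)) -> f a <= f b.
Proof.
move=> ab fg; rewrite leNgt; apply/negP => fba.
have step n : (0 < n)%N -> f a - f b <= C * ((b - a) / n%:R) * (g b - g a).
  move=> n0; have nr0 : 0 < n%:R :> K by rewrite ltr0n.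
  pose d := (b - a) / n%:R.
  have d0 : 0 <= d by rewrite divr_ge0 ?subr_ge0// ltW.
  have nd : n%:R * d = b - a by rewrite /d; field; rewrite gt_eqF.
  have bE : b = a + n%:R * d by rewrite nd; ring.
  have main i : (i <= n)%N ->
      f a - f (a + i%:R * d) <= C * d * (g (a + i%:R * d) - g a).
    elim: i => [_|i IH ltin]; first by rewrite mul0r addr0 !subrr mulr0.
    have id0 : 0 <= i%:R * d by rewrite mulr_ge0.
    have Sid : (i.+1%:R * d = i%:R * d + d :> K) by rewrite -addn1 natrD; ring.
    have Sin : i.+1%:R * d <= n%:R * d by rewrite ler_wpM2r// ler_nat.
    have /fg : a <= a + i%:R * d by lra.
    move=> /(_ (a + i.+1%:R * d)).
    have -> : a + i.+1%:R * d - (a + i%:R * d) = d by rewrite Sid; ring.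
    have -> : a + i%:R * d <= a + i.+1%:R * d by lra.
    have -> : a + i.+1%:R * d <= b by rewrite bE; lra.
    by move=> /(_ isT isT); have := IH (ltnW ltin); lra.
  by have := main n (leqnn n); rewrite -bE.
pose E := C * (b - a) * (g b - g a) / (f a - f b).
have fab : 0 < f a - f b by rewrite subr_gt0.
have /archi_boundP := normr_ge0 E; set n := Num.bound _ => En.
have n0 : (0 < n)%N by rewrite -(ltr0n K) (le_lt_trans _ En).
have := step n n0.
have -> : C * ((b - a) / n%:R) * (g b - g a) = E * (f a - f b) / n%:R.
  by rewrite /E; field; rewrite pnatr_eq0 -lt0n n0 gt_eqF.
rewrite ler_pdivlMr ?ltr0n// mulrC ler_pM2r// leNgt.
by rewrite (le_lt_trans (ler_norm _) En).
Qed.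

(** * Real-valued integrals over compact intervals *)

Section IntervalIntegral.
Variable K : realType.
Implicit Types (a b c : K) (f g : K -> K).

Definition Itg f a b : K := \int[lebesgue_measure]_(r in `[a, b]) f r.

Definition itgb f a b : Prop :=
  (@lebesgue_measure K).-integrable `[a, b] (EFin \o f).

Lemma itgbS f a b c d : itgb f a b -> a <= c -> d <= b -> itgb f c d.
Proof.
move=> fab ac db; apply: integrableS fab => //.
by apply: subset_itv; rewrite bnd_simp.
Qed.

Lemma itgb_bounded f a b C : measurable_fun `[a, b] f ->
  (forall x, a <= x <= b -> `|f x| <= C) -> itgb f a b.
Proof.
move=> mf fC; apply: measurable_bounded_integrable => //.
  by rewrite /= lebesgue_measure_itv/=; case: ifP => _; rewrite ?ltry.
exists C; split; first by rewrite num_real.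
move=> M CM x /=; rewrite in_itv/= => xab.
exact: le_trans (fC _ xab) (ltW CM).
Qed.

(** Preimages of rays under a monotone function are order-convex. Open intervals are allowed because
    the slope of a profile is monotone only away from R. *)
Lemma measurable_mono_itv (D : interval K) f :
  {in D &, nondecreasing_fun f} -> measurable_fun [set` D] f.
Proof.
move=> fnd mD; apply: (measurability (@measurable_realfun.RGenCInfty.G K)) => //=.
  exact: measurable_realfun.RGenCInfty.measurableE.
move=> _ [_] [r] -> <-; apply: is_interval_measurable => s t/=.
move=> [Ds fs] [Dt _] u sut.
have Du : u \in D by exact: (interval_is_interval Ds Dt sut).
split; first exact: Du.
move: fs; rewrite /= !in_itv/= !andbT => fs.
by rewrite (le_trans fs)// fnd//; case/andP: sut.
Qed.

Lemma itgb_nd f a b : {in `[a, b] &, nondecreasing_fun f} -> itgb f a b.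
Proof.
move=> fnd; have [ab|ba] := leP a b; last first.
  by rewrite /itgb set_itv_ge ?bnd_simp -?ltNge//; exact: integrable_set0.
apply: (itgb_bounded (C := `|f a| + `|f b|)); first exact: measurable_mono_itv.
move=> x /andP[ax xb].
have xab : x \in `[a, b] by rewrite in_itv/= ax.
have aab : a \in `[a, b] by rewrite in_itv/= lexx.
have bab : b \in `[a, b] by rewrite in_itv/= lexx andbT.
have := fnd _ _ aab xab ax; have := fnd _ _ xab bab xb.
have := ler_norm (f b); have := ler_norm (- f a); rewrite normrN.
have := normr_ge0 (f a); have := normr_ge0 (f b).
by rewrite ler_norml => *; apply/andP; split; lra.
Qed.

Lemma itgb_cst a b k : itgb (cst k) a b.
Proof. by apply: itgb_nd. Qed.

Lemma itgbZ f a b k : itgb f a b -> itgb (fun r => k * f r) a b.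
Proof. by move=> fi; exact: (integrableZl _ k fi). Qed.

Lemma itgbD f g a b : itgb f a b -> itgb g a b -> itgb (fun r => f r + g r) a b.
Proof. by move=> fi gi; exact: (integrableD _ fi gi). Qed.

Lemma itgbB f g a b : itgb f a b -> itgb g a b -> itgb (fun r => f r - g r) a b.
Proof. by move=> fi gi; exact: (integrableB _ fi gi). Qed.

Lemma eq_Itg f g a b : (forall x, a <= x <= b -> f x = g x) ->
  Itg f a b = Itg g a b.
Proof. by move=> fg; apply: eq_Rintegral => x; rewrite inE/= in_itv/= => /fg. Qed.

Lemma Itgaa f a : Itg f a a = 0.
Proof. by rewrite /Itg set_itv1 Rintegral_set1. Qed.

Lemma Itg_cst a b k : a <= b -> Itg (cst k) a b = k * (b - a).
Proof.
move=> ab; rewrite /Itg Rintegral_cst//= lebesgue_measure_itv/= lte_fin.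
by move: ab; rewrite le_eqVlt => /predU1P[->|ab]; rewrite ?ltxx ?subrr ?ab.
Qed.

Lemma ItgZ f a b k : itgb f a b -> Itg (fun r => k * f r) a b = k * Itg f a b.
Proof. by move=> fi; exact: RintegralZl. Qed.

Lemma ItgD f g a b : itgb f a b -> itgb g a b ->
  Itg (fun r => f r + g r) a b = Itg f a b + Itg g a b.
Proof. by move=> fi gi; exact: RintegralD. Qed.

Lemma ItgB f g a b : itgb f a b -> itgb g a b ->
  Itg (fun r => f r - g r) a b = Itg f a b - Itg g a b.
Proof. by move=> fi gi; exact: RintegralB. Qed.

Lemma le_Itg f g a b : itgb f a b -> itgb g a b ->
  (forall x, a <= x <= b -> f x <= g x) -> Itg f a b <= Itg g a b.
Proof.
by move=> fi gi fg; apply: le_Rintegral => // x; rewrite /= in_itv/= => /fg.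
Qed.

Lemma Itg_chasles f a b c : itgb f a b -> a <= c -> c <= b ->
  Itg f a b = Itg f a c + Itg f c b.
Proof.
move=> fi ac cb.
have /eqP := @Rintegral_itvB K f (BLeft a) (BRight b) c fi ac cb.
rewrite subr_eq addrC => /eqP; rewrite /Itg => ->; congr (_ + _).
rewrite Rintegral_itv_obnd_cbnd//; apply: integrableS fi => //.
by apply: subset_itvr; rewrite bnd_simp.
Qed.

Lemma Itg_ge0 f a b : (forall x, a <= x <= b -> 0 <= f x) -> 0 <= Itg f a b.
Proof. by move=> f0; apply: Rintegral_ge0 => x; rewrite /= in_itv/= => /f0. Qed.

Lemma Itg_ge_cst f a b k : a <= b -> itgb f a b ->
  (forall x, a <= x <= b -> k <= f x) -> k * (b - a) <= Itg f a b.
Proof.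
by move=> ab fi kf; rewrite -Itg_cst//; apply: le_Itg => //; exact: itgb_cst.
Qed.

Lemma Itg_le_cst f a b k : a <= b -> itgb f a b ->
  (forall x, a <= x <= b -> f x <= k) -> Itg f a b <= k * (b - a).
Proof.
by move=> ab fi kf; rewrite -Itg_cst//; apply: le_Itg => //; exact: itgb_cst.
Qed.

Lemma ae_exists_itv (P : K -> Prop) a b : a < b ->
  {ae (@lebesgue_measure K), forall x, P x} -> exists x, a < x < b /\ P x.
Proof.
move=> ab [N [mN N0 PN]]; apply: contrapT => nex.
have sub : `]a, b[ `<=` N.
  move=> x; rewrite /= in_itv/= => xab; apply: PN => /= Px.
  by apply: nex; exists x.
have := le_measure (@lebesgue_measure K) (mem_set (measurable_itv _))
  (mem_set mN) sub.
by rewrite /= N0 lebesgue_measure_itv/= lte_fin ab EFinN lee_fin; lra.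
Qed.

(** Signs and equalities are often known only in the interior; the open interval carries the same
    integral. *)
Lemma Itg_oo f a b : itgb f a b ->
  (@lebesgue_measure K).-integrable `]a, b[ (EFin \o f) /\
  Itg f a b = fine (\int[lebesgue_measure]_(x in `]a, b[) (f x)%:E)%E.
Proof.
move=> fi; have fio : (@lebesgue_measure K).-integrable `]a, b[ (EFin \o f).
  by apply: integrableS fi => //; apply: subset_itvW.
split => //; rewrite /Itg /Rintegral (@integral_itv_bndoo K a b _ true false)//.
by have /integrableP[] := fio.
Qed.

Lemma Itg_ge0_oo f a b : itgb f a b -> (forall x, a < x < b -> 0 <= f x) ->
  0 <= Itg f a b.
Proof.
by move=> /Itg_oo[_ ->] f0; rewrite fine_ge0// integral_ge0.
Qed.

Lemma Itg_eq0_ae_oo f a b : itgb f a b -> (forall x, a < x < b -> 0 <= f x) ->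
  Itg f a b = 0 ->
  {ae (@lebesgue_measure K), forall x, a < x < b -> f x = 0}.
Proof.
move=> /Itg_oo[fi ->] f0 If.
have /integrableP[mf _] := fi.
have [+ _] := ae_eq_integral_abs (@lebesgue_measure K) (measurable_itv `]a, b[) mf.
rewrite (_ : integral _ _ _ = 0%E).
  move=> /(_ erefl).
  apply: filterS => x /= + xab.
  by rewrite in_itv/= xab => /(_ isT) [].
transitivity (\int[lebesgue_measure]_(x in `]a, b[) (EFin \o f) x)%E.
  apply: eq_integral => x; rewrite inE/= in_itv/= => /f0 fx.
  by rewrite /= ger0_norm.
move/eqP: If; rewrite fine_eq0; first by move/eqP.
exact: integrable_fin_num.
Qed.

Lemma eq_Itg_ae f g a b : itgb f a b -> itgb g a b ->
  {ae (@lebesgue_measure K), forall x, a < x < b -> f x = g x} ->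
  Itg f a b = Itg g a b.
Proof.
move=> /Itg_oo[fi ->] /Itg_oo[gi ->] fg; congr fine.
have /integrableP[mf _] := fi; have /integrableP[mg _] := gi.
apply: (@ae_eq_integral _ _ _ (@lebesgue_measure K) `]a, b[ (EFin \o g) (EFin \o f)) => //.
move: fg; apply: filterS; first exact: (ae_filter_ringOfSetsType (@lebesgue_measure K)).
by move=> x fg /=; rewrite in_itv/= => /fg ->.
Qed.

Lemma Itg_gt0 f a b c d : itgb f a b -> (forall x, a <= x <= b -> 0 <= f x) ->
  a <= c -> c < d -> d <= b -> (forall x, c < x < d -> 0 < f x) -> 0 < Itg f a b.
Proof.
move=> fi f0 ac cd db fp; rewrite lt_neqAle Itg_ge0// andbT eq_sym.
have f0' x : a < x < b -> 0 <= f x by move=> /andP[ax xb]; rewrite f0// !ltW.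
apply/eqP => /(Itg_eq0_ae_oo fi f0') /(ae_exists_itv cd)[x [xcd fx0]].
have := fp _ xcd; rewrite fx0 ?ltxx//.
by case/andP: xcd => cx xd; apply/andP; split; lra.
Qed.

Lemma measurable_sub_refl a : measurable_fun [set: measurableTypeR K]
  (fun r : measurableTypeR K => (a - r : measurableTypeR K)).
Proof. by apply: nonincreasing_measurable => // x y xy; rewrite lerB. Qed.

(** By uniqueness of Lebesgue measure it is enough to test half-open intervals, and reflection turns
    ]s, t] into [a - t, a - s[, of the same length. *)
Lemma lebesgue_measure_refl a (A : set (measurableTypeR K)) : measurable A ->
  lebesgue_measure A =
  pushforward (@lebesgue_measure K) (fun r : measurableTypeR K => (a - r : measurableTypeR K)) A.
Proof.
move=> mA.
pose mu' : {measure set (measurableTypeR K) -> \bar K} :=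
  measure_function_pushforward__canonical__measure_function_Measure
    (@lebesgue_measure K) (measurable_sub_refl a).
apply: (@lebesgue_measure_unique K mu') => // X [[s t] _ <-].
rewrite /mu' /= /pushforward.
have -> : (fun r : K => a - r) @^-1` `]s, t] = `[a - t, a - s[%classic.
  by apply/seteqP; split => r /=; rewrite !in_itv/= => /andP[? ?]; apply/andP; split; lra.
rewrite !lebesgue_measure_itv/= !lte_fin ltrD2l ltrN2.
by case: ifP => // _; rewrite -!EFinB; congr EFin; ring.
Qed.

(** Change of variables through the pushforward measure, in the version for nonnegative integrands;
    integrability of the reflected function is the same formula applied to |f|. *)
Lemma Itg_refl f a : (forall x, 0 <= x <= a -> 0 <= f x) -> itgb f 0 a ->
  itgb (fun r => f (a - r)) 0 a /\
  Itg (fun r => f (a - r)) 0 a = Itg f 0 a.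
Proof.
move=> f0 fi; have /integrableP[mf fy] := fi.
pose phi : measurableTypeR K -> measurableTypeR K := fun r : K => a - r.
have mphi : measurable_fun [set: measurableTypeR K] phi.
  exact: measurable_sub_refl.
pose mu' : {measure set (measurableTypeR K) -> \bar K} :=
  measure_function_pushforward__canonical__measure_function_Measure
    (@lebesgue_measure K) mphi.
have phiE : phi @^-1` `[0, a] = `[0, a]%classic.
  by apply/seteqP; split => r; rewrite /phi/= !in_itv/= => /andP[? ?];
    apply/andP; split; lra.
have muE (g : K -> \bar K) : (\int[mu']_(x in `[0%R, a]) g x =
    \int[lebesgue_measure]_(x in `[0%R, a]) g x)%E.
  by apply: eq_measure_integral => A mA _; exact/esym/(lebesgue_measure_refl a mA).
have mfr : measurable_fun `[0, a] (EFin \o (f \o phi)).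
  rewrite -phiE; apply: (measurable_comp _ _ mf) => //.
  by move=> x [y /= + <-].
  exact: measurable_funTS.
have ifr : itgb (f \o phi) 0 a.
  apply/integrableP; split => //.
  rewrite -{1}phiE -(@ge0_integral_pushforward _ _ _ _ _ phi mphi (@lebesgue_measure K) _
    (fun x => `|(f x)%:E|%E))//.
    by rewrite muE.
  exact: measurableT_comp.
split => //; rewrite /Itg /Rintegral; congr fine.
rewrite -[RHS]muE -{1}phiE.
rewrite -(@ge0_integral_pushforward _ _ _ _ _ phi mphi (@lebesgue_measure K) _
  (EFin \o f))// => x.
by rewrite inE/= in_itv/= lee_fin => /f0.
Qed.
End IntervalIntegral.

(** * The function h, the drag and the pointwise Lagrangian minimum *)

Section SlopeFunction.
Variable K : realType.
Implicit Types (k r p s t q x c g : K).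

Lemma hN t : h (- t) = t / (1 + t ^+ 2) ^+ 2.
Proof. by rewrite /h opprK sqrrN. Qed.

Lemma hN_gt0 t : 0 < t -> 0 < h (- t).
Proof. by move=> t0; rewrite hN divr_gt0// exprn_gt0//; nra. Qed.

Lemma hN_decr s t : 1 <= s -> s < t -> h (- t) < h (- s).
Proof.
move=> s1 st; rewrite !hN.
have ps : 0 < (1 + s ^+ 2) ^+ 2 by rewrite exprn_gt0//; nra.
have pt : 0 < (1 + t ^+ 2) ^+ 2 by rewrite exprn_gt0//; nra.
rewrite ltr_pdivrMr// mulrAC ltr_pdivlMr// -subr_gt0.
have -> : s * (1 + t ^+ 2) ^+ 2 - t * (1 + s ^+ 2) ^+ 2 =
  (t - s) * (s * t * (2 + s ^+ 2 + s * t + t ^+ 2) - 1) by ring.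
have st1 : 1 < s * t by nra.
by apply: mulr_gt0; [lra|nra].
Qed.

(** The product t h(-t) is the square of t / (1 + t^2), which decreases on [1, +oo[. So h(-t) decays
    at least as fast as 1 / t, which limits how fast the slope grows when k / r falls. *)
Lemma mul_hN_le s t : 1 <= s -> s <= t -> t * h (- t) <= s * h (- s).
Proof.
move=> s1 st; rewrite !hN.
have ps : 0 < (1 + s ^+ 2) ^+ 2 by rewrite exprn_gt0//; nra.
have pt : 0 < (1 + t ^+ 2) ^+ 2 by rewrite exprn_gt0//; nra.
rewrite !mulrA ler_pdivrMr// mulrAC ler_pdivlMr// -!expr2 -!exprMn.
rewrite ler_sqr ?nnegrE ?mulr_ge0//; try nra.
have : 0 <= (t - s) * (s * t - 1) by apply: mulr_ge0; nra.
lra.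
Qed.

Lemma hN1 : h (- 1) = 4^-1 :> K.
Proof. by rewrite hN; field. Qed.

Lemma mul_hN_le4 t : t * h (- t) <= 4^-1.
Proof.
rewrite hN mulrA ler_pdivrMr ?exprn_gt0//; last by nra.
have : 0 <= (1 - t ^+ 2) ^+ 2 by exact: sqr_ge0.
by nra.
Qed.

Lemma hN_le_quarter t : 1 <= t -> h (- t) <= 4^-1.
Proof.
rewrite le_eqVlt => /predU1P[<-|t1]; first by rewrite hN1.
by rewrite -hN1; exact/ltW/hN_decr.
Qed.

Lemma hinvK t : 1 <= t -> hinv (h (- t)) = - t.
Proof.
move=> t1; rewrite /hinv pinvKV ?inE/= ?in_itv/= ?lerN2//.
move=> x y; rewrite !inE/= !in_itv/= => x1 y1 hxy.
have x1' : 1 <= - x by rewrite lerNr.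
have y1' : 1 <= - y by rewrite lerNr.
have [xy|xy|//] := ltgtP x y.
- have yx : - y < - x by rewrite ltrN2.
  by have := hN_decr y1' yx; rewrite !opprK hxy ltxx.
- have xy' : - x < - y by rewrite ltrN2.
  by have := hN_decr x1' xy'; rewrite !opprK hxy ltxx.
Qed.

Lemma hN_onto k : 0 < k -> k <= 4^-1 -> exists2 t, 1 <= t & h (- t) = k.
Proof.
(* Since T h(-T) <= 1/4, this T has h(-T) <= k / 4, so k is crossed on [1, T]. *)
move=> k0 k4; pose T := k^-1.
have kT : k * T = 1 by rewrite /T mulfV ?gt_eqF.
have T1 : 1 <= T by nra.
have cont : {within `[1, T], continuous (fun t => h (- t))}.
  apply: continuous_subspaceT => t.
  under eq_fun do rewrite hN.
  apply: cvgM; first exact: cvg_id.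
  apply: cvgV; first by rewrite gt_eqF// exprn_gt0//; nra.
  by apply: cvgM; (apply: cvgD; [exact: cvg_cst|apply: cvgM; exact: cvg_id]).
have hT : h (- T) <= k.
  rewrite -(ler_pM2l (lt_le_trans ltr01 T1)) [T * k]mulrC kT.
  by have := mul_hN_le4 T; lra.
have [|t] := @IVT K (fun t => h (- t)) 1 T k T1 cont.
  by rewrite hN1 ge_min le_max hT k4 orbT.
by rewrite in_itv/= => /andP[t1 _] tk; exists t.
Qed.

(* The minimiser of p |-> r / (1 + p^2) + 2 k p over p >= 0: when 4 k <= r it is
   the solution p >= 1 of k = r h(-p), otherwise it is 0. *)
Definition slope k r := if 4 * k <= r then - hinv (k / r) else 0.

Lemma slopeP k r : 0 < k -> 4 * k <= r ->
  1 <= slope k r /\ k = r * h (- slope k r).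
Proof.
move=> k0 kr; rewrite /slope kr.
have r0 : 0 < r by lra.
have [||t t1 ht] := @hN_onto (k / r).
- by rewrite divr_gt0.
- by rewrite ler_pdivrMr//; lra.
rewrite -ht hinvK// opprK; split => //.
by rewrite ht; field; rewrite gt_eqF.
Qed.

Lemma slope_uniq k r t : 0 < r -> 1 <= t -> k = r * h (- t) ->
  4 * k <= r /\ slope k r = t.
Proof.
move=> r0 t1 ->; have := hN_le_quarter t1 => h4.
have le4 : 4 * (r * h (- t)) <= r by nra.
split => //; rewrite /slope le4.
by rewrite [r * _]mulrC mulfK ?gt_eqF// hinvK// opprK.
Qed.

Lemma slope_small k r : r < 4 * k -> slope k r = 0.
Proof. by move=> kr; rewrite /slope leNgt kr. Qed.

Lemma slope_ge0 k r : 0 < k -> 0 <= slope k r.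
Proof.
move=> k0; have [kr|kr] := leP (4 * k) r.
  by have [+ _] := slopeP k0 kr; lra.
by rewrite slope_small.
Qed.

Lemma slope_ub k r : 0 < k -> 0 < r -> slope k r <= r / (4 * k).
Proof.
move=> k0 r0; have [kr|kr] := leP (4 * k) r; last first.
  by rewrite slope_small// divr_ge0; lra.
have [s1 ks] := slopeP k0 kr; rewrite ler_pdivlMr; last by lra.
have := mul_hN_le4 (slope k r) => s4; rewrite {2}ks.
have : r * (slope k r * h (- slope k r)) <= r * 4^-1 by rewrite ler_pM2l.
lra.
Qed.

(** The slope depends on k / r only and is nonincreasing in it; the last hypothesis is k1 / r1 <= k2
    / r2 without denominators. *)
Lemma slope_homo k1 k2 r1 r2 : 0 < k1 -> 0 < k2 -> 0 < r1 -> 0 < r2 ->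
  k1 * r2 <= k2 * r1 -> slope k2 r2 <= slope k1 r1.
Proof.
move=> k10 k20 r10 r20 kr.
have [k2r|k2r] := leP (4 * k2) r2; last first.
  by rewrite [slope k2 r2]slope_small//; exact: slope_ge0.
have k1r : 4 * k1 <= r1 by nra.
have [s1 e1] := slopeP k10 k1r; have [s2 e2] := slopeP k20 k2r.
rewrite leNgt; apply/negP => lt12.
have := hN_decr s1 lt12; rewrite ltNge => /negP; apply.
have r12 : 0 < r1 * r2 by exact: mulr_gt0.
rewrite -(ler_pM2l r12); move: kr; rewrite {1}e1 {1}e2.
by set u := h _; set v := h _ => ?; lra.
Qed.

(** Counterpart of [slope_homo]: by [mul_hN_le], the slope times k / r is nondecreasing in k / r, so
    the slope grows at most in inverse proportion to k / r. The bound on k2 keeps away from the jump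
    of the slope from 0 to 1. *)
Lemma slope_elastic k1 k2 r1 r2 : 0 < k1 -> 0 < k2 -> 0 < r1 -> 0 < r2 ->
  4 * k2 <= r2 ->
  k1 * r2 <= k2 * r1 -> slope k1 r1 * (k1 * r2) <= slope k2 r2 * (k2 * r1).
Proof.
move=> k10 k20 r10 r20 k2r kr.
have k1r : 4 * k1 <= r1 by nra.
have [s1 e1] := slopeP k10 k1r; have [s2 e2] := slopeP k20 k2r.
have s21 := slope_homo k10 k20 r10 r20 kr.
have := mul_hN_le s2 s21; set a := slope k1 r1 in e1 *; set b := slope k2 r2 in e2 *.
move=> H; rewrite e1 e2.
have r12 : 0 < r1 * r2 by exact: mulr_gt0.
by have : r1 * r2 * (a * h (- a)) <= r1 * r2 * (b * h (- b)); [rewrite ler_pM2l|nra].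
Qed.

Definition drag p := (1 + p ^+ 2)^-1.

Lemma drag_gt0 p : 0 < drag p. Proof. by rewrite invr_gt0; nra. Qed.

Lemma drag_le1 p : drag p <= 1.
Proof. by rewrite /drag invf_le1; nra. Qed.

Lemma le_drag p s : s ^+ 2 <= p ^+ 2 -> drag p <= drag s.
Proof. by move=> sp; rewrite lef_pV2 ?posrE; nra. Qed.

Lemma lt_drag p s : s ^+ 2 < p ^+ 2 -> drag p < drag s.
Proof. by move=> sp; rewrite ltf_pV2 ?posrE; nra. Qed.

(** The derivative of [drag] at t is -2 h(-t), so this is the tangent line at t. [drag] is not
    convex on p >= 0; but after removal of the double root p = t the remaining factor 2 t p + t^2 -
    1 is nonnegative because t >= 1. *)
Lemma drag_tangent t p : 1 <= t -> 0 <= p ->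
  drag t + 2 * h (- t) * t <= drag p + 2 * h (- t) * p.
Proof.
move=> t1 p0; rewrite -subr_ge0 hN /drag.
have pp : 0 < 1 + p ^+ 2 by nra.
have pt : 0 < 1 + t ^+ 2 by nra.
have -> : (1 + p ^+ 2)^-1 + 2 * (t / (1 + t ^+ 2) ^+ 2) * p -
  ((1 + t ^+ 2)^-1 + 2 * (t / (1 + t ^+ 2) ^+ 2) * t) =
  (2 * t * p + (t ^+ 2 - 1)) * (p - t) ^+ 2 / ((1 + p ^+ 2) * (1 + t ^+ 2) ^+ 2).
  by field; rewrite !gt_eqF.
by apply: divr_ge0; apply: mulr_ge0; rewrite ?sqr_ge0//; nra.
Qed.

(** Strict positivity of p matters: the tangent at t = 1 also touches [drag] at p = 0. *)
Lemma drag_tangent_eq t p : 1 <= t -> 0 < p ->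
  drag t + 2 * h (- t) * t = drag p + 2 * h (- t) * p -> p = t.
Proof.
move=> t1 p0 /eqP; rewrite -subr_eq0 hN /drag.
have pp : 0 < 1 + p ^+ 2 by nra.
have pt : 0 < 1 + t ^+ 2 by nra.
have -> : (1 + t ^+ 2)^-1 + 2 * (t / (1 + t ^+ 2) ^+ 2) * t -
  ((1 + p ^+ 2)^-1 + 2 * (t / (1 + t ^+ 2) ^+ 2) * p) =
  - ((2 * t * p + (t ^+ 2 - 1)) * (p - t) ^+ 2 / ((1 + p ^+ 2) * (1 + t ^+ 2) ^+ 2)).
  by field; rewrite !gt_eqF.
rewrite oppr_eq0 !mulf_eq0 invr_eq0 mulf_eq0 !expf_eq0/=.
have -> : 2 * t * p + (t ^+ 2 - 1) == 0 = false by apply/eqP; nra.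
rewrite (gt_eqF pp) (gt_eqF pt)/= !orbF orbb subr_eq0; exact: eqP.
Qed.

(** The line is the tangent at t = 1, which passes through (0, 1). When r < 4 k the multiplier
    outweighs its slope, and p = 0 becomes the minimiser. *)
Lemma drag_chord p : 0 <= p -> 1 - p / 2 <= drag p.
Proof.
move=> p0; rewrite -subr_ge0 /drag.
have pp : 0 < 1 + p ^+ 2 by nra.
have -> : (1 + p ^+ 2)^-1 - (1 - p / 2) = p * (1 - p) ^+ 2 / (2 * (1 + p ^+ 2)).
  by field; rewrite !gt_eqF.
by apply: divr_ge0; apply: mulr_ge0; rewrite ?sqr_ge0//; lra.
Qed.

Definition lag k r := r * drag (slope k r) + 2 * k * slope k r.

Lemma lag_le k r p : 0 < k -> 0 < r -> 0 <= p ->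
  lag k r <= r * drag p + 2 * k * p.
Proof.
move=> k0 r0 p0; rewrite /lag; have [kr|kr] := leP (4 * k) r.
  have [s1 e] := slopeP k0 kr.
  have := drag_tangent s1 p0; rewrite -(ler_pM2l r0).
  set s := slope k r in s1 e *; move=> H; rewrite {1}e [X in _ <= _ + 2 * X * _]e; lra.
rewrite slope_small// {1}/drag expr0n addr0 invr1 mulr0 addr0.
have := drag_chord p0; rewrite -(ler_pM2l r0); nra.
Qed.

Lemma lag_eq k r p : 0 < k -> 0 < r -> 0 < p ->
  lag k r = r * drag p + 2 * k * p -> p = slope k r.
Proof.
move=> k0 r0 p0; rewrite /lag; have [kr|kr] := leP (4 * k) r; last first.
  rewrite slope_small// {1}/drag expr0n addr0 invr1 mulr0 addr0.
  by have := drag_chord (ltW p0); rewrite -(ler_pM2l r0); nra.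
have [s1 e] := slopeP k0 kr; set s := slope k r in s1 e *.
move=> H; apply: (drag_tangent_eq s1 p0); apply: (mulfI (lt0r_neq0 r0)).
by move: H; rewrite {1}e [X in _ = _ + 2 * X * _]e; lra.
Qed.

End SlopeFunction.

(** * The slope gamma and the threshold multiplier *)

Section Threshold.
Variable K : realType.
Implicit Types (k r p s t q x y z a c g R : K).

(** The square of gamma is the larger root G of G^2 = (1 + 3 X) G + X, whose discriminant is 9 X^2 +
    10 X + 1. *)
Lemma gammaP q a : let X := (q * a) ^+ 2 in let g := gamma q a in
  [/\ g ^+ 2 * g ^+ 2 = g ^+ 2 * (1 + 3 * X) + X, 1 + 2 * X <= g ^+ 2 & 1 <= g].
Proof.
move=> X g.
have X0 : 0 <= X by exact: sqr_ge0.
pose D : K := 9 * X ^+ 2 + 10 * X + 1.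
have DE : 9 * a ^+ 4 * q ^+ 4 + 10 * a ^+ 2 * q ^+ 2 + 1 = D by rewrite /D /X; ring.
have s0 := sqrtr_ge0 D; set s := Num.sqrt D in s0.
have sD : s ^+ 2 = D by rewrite sqr_sqrtr// /D; nra.
have s1 : 1 + X <= s by rewrite /D in sD; nra.
have gE : g ^+ 2 = 2^-1 * (3 * X + 1 + s).
  rewrite /g /gamma DE -/s sqr_sqrtr.
    by rewrite /X; ring.
  have -> : 3 * a ^+ 2 * q ^+ 2 = 3 * X by rewrite /X; ring.
  by lra.
have g0 : 0 <= g by exact: sqrtr_ge0.
have g1 : 1 + 2 * X <= g ^+ 2 by rewrite gE; lra.
split => //; last by nra.
by rewrite gE; rewrite /D in sD; nra.
Qed.

(** A crude bound (at q a = 1 the value is about 2.06), used to keep thresholds away from 0. *)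
Lemma gamma_le3 q a : 0 <= q * a -> q * a <= 1 -> gamma q a <= 3.
Proof.
move=> c0 c1; have [gE g2 g1] := gammaP q a; set g := gamma q a in gE g2 g1 *.
have X1 : (q * a) ^+ 2 <= 1 by nra.
set X := (q * a) ^+ 2 in gE g2 X1.
rewrite leNgt; apply/negP => g3.
have : 9 < g ^+ 2 by nra.
by move: gE; set G := g ^+ 2; nra.
Qed.

(** The tangent to [drag] at gamma meets the axis p = 0 at the height [drag (q * a)]. This is the
    origin of the formula for gamma. *)
Lemma drag_gamma q a :
  drag (q * a) = drag (gamma q a) + 2 * h (- gamma q a) * gamma q a.
Proof.
have [gE g2 g1] := gammaP q a; set g := gamma q a in gE g2 g1 *.
rewrite hN /drag; set X := (q * a) ^+ 2 in gE g2 *.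
have X0 : 0 <= X by exact: sqr_ge0.
have G0 : 0 <= g ^+ 2 by exact: sqr_ge0.
apply: (@mulIf _ ((1 + X) * (1 + g ^+ 2) ^+ 2)).
  by rewrite mulf_neq0 ?expf_neq0// gt_eqF//; lra.
transitivity ((1 + g ^+ 2) ^+ 2); first by field; rewrite gt_eqF//; lra.
transitivity ((1 + 3 * g ^+ 2) * (1 + X)); last by field; rewrite gt_eqF//; lra.
have -> : (1 + g ^+ 2) ^+ 2 = 1 + 2 * g ^+ 2 + g ^+ 2 * g ^+ 2 by ring.
by rewrite gE; ring.
Qed.

Definition threshold q a := a * h (- gamma q a).

Lemma gamma0 a : gamma 0 a = 1.
Proof.
rewrite /gamma !expr0n/= !mulr0 !add0r sqrtr1.
by rewrite (_ : 2^-1 * (1 + 1) = 1) ?sqrtr1//; field.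
Qed.

Lemma threshold0 a : threshold 0 a = a / 4.
Proof. by rewrite /threshold gamma0 hN1. Qed.

Lemma threshold_gt0 q a : 0 < a -> 0 < threshold q a.
Proof.
move=> a0; have [_ _ g1] := gammaP q a.
by rewrite mulr_gt0// hN_gt0//; lra.
Qed.

Lemma threshold_le4 q a : 0 < a -> 4 * threshold q a <= a.
Proof.
move=> a0; have [_ _ g1] := gammaP q a.
by have [] := @slope_uniq K (threshold q a) a (gamma q a) a0 g1 erefl.
Qed.

Lemma slope_threshold q a : 0 < a -> slope (threshold q a) a = gamma q a.
Proof.
move=> a0; have [_ _ g1] := gammaP q a.
by have [] := @slope_uniq K (threshold q a) a (gamma q a) a0 g1 erefl.
Qed.

Lemma lag_threshold q a : 0 < a -> lag (threshold q a) a = a * drag (q * a).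
Proof.
move=> a0; rewrite /lag slope_threshold// drag_gamma /threshold; ring.
Qed.

(* [threshold] does not stay monotone up to q z = 1.  The constant 16/25 is small
   enough for the polynomial inequality below and large enough that
   1 - 16/25 < (16/25)^2, which is what [zeta_decr_far] needs. *)
Lemma threshold_homo q y z : 0 <= q -> 0 < y -> y <= z -> q * z <= 16 / 25 ->
  threshold q y <= threshold q z.
Proof.
move=> q0 y0 yz qz; have z0 : 0 < z by lra.
rewrite leNgt; apply/negP => kzy.
have [gE _ g1] := gammaP q y.
have g0 : 0 < gamma q y by lra.
(* Testing the minimum at z with the slope gamma of y, instead of its own minimiser, leaves only one
   root equation in the comparison. *)
have := lag_le (threshold_gt0 q z0) z0 (ltW g0).
rewrite lag_threshold// => lz.
have ly := lag_threshold q y0; rewrite /lag slope_threshold// in ly.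
have {lz ly} : z * drag (q * z) - y * drag (q * y) < (z - y) * drag (gamma q y).
  have : threshold q z * gamma q y < threshold q y * gamma q y by rewrite ltr_pM2r.
  by lra.
apply/negP; rewrite -leNgt /drag.
set g := gamma q y in gE g1 g0 *; set G := g ^+ 2 in gE *.
have c1 : 0 <= q * y by rewrite mulr_ge0// ltW.
have c12 : q * y <= q * z by rewrite ler_wpM2l.
have G1 : 1 <= G by rewrite /G; nra.
have -> : z * (1 + (q * z) ^+ 2)^-1 - y * (1 + (q * y) ^+ 2)^-1 =
  (z - y) * ((1 - (q * y) * (q * z)) / ((1 + (q * y) ^+ 2) * (1 + (q * z) ^+ 2))).
  by field; rewrite !gt_eqF//; nra.
rewrite ler_wpM2l ?subr_ge0//.
move: (q * y) (q * z) c1 c12 qz gE => c d c0 cd d1 gE.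
pose X := c ^+ 2; have X0 : 0 <= X by exact: sqr_ge0.
have X1 : X <= 256 / 625 by rewrite /X; nra.
(* The root G is concave in X, equals 1 at X = 0 and about 2.3995 at X = (16/25)^2; so it lies above
   its chord, of slope slightly more than 341/100. *)
have lbG : 1 + 341 / 100 * X <= G.
  rewrite leNgt; apply/negP => ltG; move: gE; rewrite -/X => gE.
  have : 0 < (1 + 341 / 100 * X - G) * (1 + 341 / 100 * X + G - 1 - 3 * X).
    by apply: mulr_gt0; lra.
  by nra.
have pc : 0 < 1 + c ^+ 2 by nra.
have pd : 0 < 1 + d ^+ 2 by nra.
rewrite -div1r ler_pdivrMr; last by lra.
rewrite mulrAC ler_pdivlMr ?mulr_gt0// mul1r.
(* The quotient (1 - c d) / (1 + d^2) decreases in d, so d = 16/25 is the worst case. *)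
have step1 : (1 - c * (16 / 25)) * (1 + d ^+ 2) <= (1 - c * d) * (1 + (16 / 25) ^+ 2).
  rewrite -subr_ge0.
  have -> : (1 - c * d) * (1 + (16 / 25) ^+ 2) - (1 - c * (16 / 25)) * (1 + d ^+ 2) =
    (16 / 25 - d) * (16 / 25 + d + c - c * d * (16 / 25)) by ring.
  by apply: mulr_ge0; nra.
have step2 : (1 + c ^+ 2) * (1 + (16 / 25) ^+ 2) <= (1 - c * (16 / 25)) * (1 + G).
  apply: (@le_trans _ _ ((1 - c * (16 / 25)) * (2 + 341 / 100 * X))); last first.
    by apply: ler_wpM2l; lra.
  have : 0 <= (16 / 25 - c) * (128 / 100 - 20004 / 10000 * (16 / 25 + c)
      + 21824 / 10000 * ((16 / 25) ^+ 2 + 16 / 25 * c + c ^+ 2)).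
    by apply: mulr_ge0; nra.
  by rewrite /X; nra.
have G10 : 0 < 1 + (16 / 25) ^+ 2 :> K by lra.
rewrite -(ler_pM2r G10).
apply: (@le_trans _ _ ((1 - c * (16 / 25)) * (1 + G) * (1 + d ^+ 2))).
  by rewrite mulrAC ler_pM2r.
by rewrite mulrAC [X in _ <= X]mulrAC ler_wpM2r//; lra.
Qed.

(** The threshold may fall, but not faster than 1 / z. The test of [threshold_homo], weighted by y
    and z, now reduces to (1 + c^2) (1 + d^2) <= 1 + G, which holds because d <= 1 and G >= 1 + 2
    c^2. *)
Lemma mul_threshold_homo q y z : 0 <= q -> 0 < y -> y <= z -> q * z <= 1 ->
  y * threshold q y <= z * threshold q z.
Proof.
move=> q0 y0 yz qz; have z0 : 0 < z by lra.
rewrite leNgt; apply/negP => kzy.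
have [gE g2 g1] := gammaP q y.
have g0 : 0 < gamma q y by lra.
have := lag_le (threshold_gt0 q z0) z0 (ltW g0).
rewrite lag_threshold// => lz.
have ly := lag_threshold q y0; rewrite /lag slope_threshold// in ly.
have {lz ly} : z ^+ 2 * drag (q * z) - y ^+ 2 * drag (q * y)
    < (z ^+ 2 - y ^+ 2) * drag (gamma q y).
  have : z * threshold q z * gamma q y < y * threshold q y * gamma q y by rewrite ltr_pM2r.
  have := lz; rewrite -(ler_pM2l z0).
  have : y * (y * drag (gamma q y) + 2 * threshold q y * gamma q y) = y * (y * drag (q * y)).
    by rewrite ly.
  by lra.
apply/negP; rewrite -leNgt /drag.
set g := gamma q y in gE g1 g2 g0 *; set G := g ^+ 2 in gE g2 *.
have c1 : 0 <= q * y by rewrite mulr_ge0// ltW.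
have c12 : q * y <= q * z by rewrite ler_wpM2l.
have -> : z ^+ 2 * (1 + (q * z) ^+ 2)^-1 - y ^+ 2 * (1 + (q * y) ^+ 2)^-1 =
  (z ^+ 2 - y ^+ 2) * ((1 + (q * y) ^+ 2) * (1 + (q * z) ^+ 2))^-1.
  by field; rewrite !gt_eqF//; nra.
apply: ler_wpM2l; first by nra.
move: (q * y) (q * z) c1 c12 qz g2 => c d c0 cd d1 g2.
rewrite lef_pV2 ?posrE; last 2 first.
- by nra.
- by apply: mulr_gt0; nra.
apply: (@le_trans _ _ ((1 + c ^+ 2) * 2)); last by lra.
by apply: ler_wpM2l; nra.
Qed.

End Threshold.

(** * Integrals of the slope and regularity of zeta in its argument *)

Section SlopeIntegral.
Variable K : realType.
Implicit Types (k r p s t q x y z a b c g R M : K).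

Lemma slope_nd k : 0 < k -> nondecreasing_fun (slope k).
Proof.
move=> k0 r s rs; have [kr|kr] := leP (4 * k) r; last first.
  by rewrite slope_small//; exact: slope_ge0.
have r0 : 0 < r by lra.
have s0 : 0 < s by lra.
by apply: slope_homo => //; rewrite ler_pM2l.
Qed.

(** For r <= 0 the value is r itself, so monotonicity, and with it integrability, holds on the whole
    line. *)
Lemma lag_nd k : 0 < k -> nondecreasing_fun (lag k).
Proof.
move=> k0 r s rs; have [r0|r0] := ltP 0 r.
  have s0 : 0 < s by lra.
  apply: le_trans (lag_le k0 r0 (slope_ge0 s k0)) _.
  by rewrite lerD2r ler_wpM2r// ltW// drag_gt0.
rewrite {1}/lag slope_small; last by lra.
rewrite {1}/drag expr0n addr0 invr1 mulr1 mulr0 addr0.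
have [s0|s0] := ltP 0 s.
  apply: le_trans r0 _; rewrite addr_ge0//.
    by rewrite mulr_ge0 ?(ltW s0)// ltW// drag_gt0.
  by rewrite !mulr_ge0 ?slope_ge0// ltW.
rewrite /lag slope_small; last by lra.
by rewrite /drag expr0n addr0 invr1 mulr1 mulr0 addr0.
Qed.

Lemma itgb_slope k a b : 0 < k -> itgb (slope k) a b.
Proof. by move=> k0; apply: itgb_nd => x y _ _; exact: slope_nd. Qed.

Lemma itgb_lag k a b : 0 < k -> itgb (lag k) a b.
Proof. by move=> k0; apply: itgb_nd => x y _ _; exact: lag_nd. Qed.

Lemma Itg_slope_threshold R q r a : 0 < a -> a <= r ->
  (- \int[lebesgue_measure]_(s in `[r, R]) hinv (a * h (- gamma q a) / s)) =
  Itg (slope (threshold q a)) r R.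
Proof.
move=> a0 ar; have k0 := threshold_gt0 q a0; have k4 := threshold_le4 q a0.
have E : forall s, r <= s <= R ->
    -1 * slope (threshold q a) s = hinv (a * h (- gamma q a) / s).
  move=> s /andP[rs _]; rewrite /slope ifT ?mulN1r ?opprK//; lra.
by rewrite -/(Itg _ r R) -(eq_Itg E) ItgZ ?mulN1r ?opprK//; exact: itgb_slope.
Qed.

Lemma zetaE R q a : 0 < a ->
  zeta R q a = Itg (slope (threshold q a)) a R.
Proof. by move=> a0; exact: Itg_slope_threshold. Qed.

(** At q = 0 gamma is 1 and h(-1) = 1/4; thus everything about a_M is the case q = 0 of the results
    on [zeta]. *)
Lemma phiE R a : 0 < a -> phi R a = zeta R 0 a.
Proof.
move=> a0; rewrite /phi /zeta; congr (- _); apply: eq_Rintegral => r _.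
by congr hinv; rewrite gamma0 hN1 invfM mulrA.
Qed.

Lemma zeta_ge R q a b N : 0 < a -> a <= b -> b <= R ->
  N <= slope (threshold q a) b -> N * (R - b) <= zeta R q a.
Proof.
move=> a0 ab bR Nb; have k0 := threshold_gt0 q a0.
rewrite zetaE// (Itg_chasles _ ab bR); last exact: itgb_slope.
rewrite -[leLHS]add0r lerD//.
  by apply: Itg_ge0 => x _; exact: slope_ge0.
apply: Itg_ge_cst => //; first exact: itgb_slope.
by move=> x /andP[bx _]; apply: le_trans Nb _; exact: slope_nd.
Qed.

Lemma zeta0_large R M : 0 < R -> 0 < M ->
  exists2 c, c \in `]0, R[ & M <= zeta R 0 c.
Proof.
move=> R0 M0; pose N := 1 + 2 * M / R.
have N1 : 1 <= N by rewrite /N lerDl divr_ge0// ltW// mulr_gt0.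
have NR : N * R = R + 2 * M by rewrite /N; field; rewrite gt_eqF.
have hN4 := hN_le_quarter N1; have hN0 := hN_gt0 (lt_le_trans ltr01 N1).
(* Chosen so that the slope with multiplier c / 4 equals N at R / 2; on [R / 2, R] it then
   contributes at least N R / 2 >= M. *)
pose c := 2 * R * h (- N).
have c0 : 0 < c by rewrite mulr_gt0// mulr_gt0.
have cR : c <= R / 2 by rewrite /c; nra.
exists c; first by rewrite in_itv/= c0/=; lra.
apply: (@le_trans _ _ (N * (R - R / 2))); first by nra.
apply: zeta_ge => //; first by lra.
have [||_ ->] := @slope_uniq K (threshold 0 c) (R / 2) N _ N1 _; rewrite ?divr_gt0//.
by rewrite threshold0 /c; field.
Qed.

(** Elasticity replaces the derivative of [hinv]: from p1 k1 <= p2 k2 follows p1 - p2 <= p2 (k2 -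
    k1) / k1, and p2 is bounded by [slope_ub]. *)
Lemma slope_lip km k1 k2 r C : 0 < km -> km <= k1 -> km <= k2 ->
  4 * k1 <= r -> 4 * k2 <= r -> r <= C ->
  `|slope k1 r - slope k2 r| <= C / (4 * km ^+ 2) * `|k1 - k2|.
Proof.
move=> km0; wlog k12 : k1 k2 / k1 <= k2 => [wl|].
  move=> h1 h2 r1 r2 rC; have [k12|/ltW k21] := leP k1 k2; first exact: wl.
  by rewrite distrC [`|k1 - _|]distrC; exact: wl.
move=> h1 h2 r1 r2 rC.
have k10 : 0 < k1 by lra.
have k20 : 0 < k2 by lra.
have r0 : 0 < r by lra.
have s21 : slope k2 r <= slope k1 r by apply: slope_homo => //; rewrite ler_pM2r.
have sel : slope k1 r * (k1 * r) <= slope k2 r * (k2 * r).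
  by apply: slope_elastic => //; rewrite ler_pM2r.
have {}sel : slope k1 r * k1 <= slope k2 r * k2.
  by rewrite -(ler_pM2r r0); lra.
have s2 := slope_ub k20 r0.
have {}s2 : slope k2 r * (4 * km) <= C.
  rewrite ler_pdivlMr in s2; last by lra.
  have := slope_ge0 r k20; nra.
rewrite ger0_norm ?subr_ge0// ler0_norm ?subr_le0// opprB.
rewrite mulrAC ler_pdivlMr; last by rewrite mulr_gt0// exprn_gt0.
have d0 : 0 <= slope k1 r - slope k2 r by lra.
apply: (@le_trans _ _ ((slope k1 r - slope k2 r) * k1 * (4 * km))).
  have : 0 <= (slope k1 r - slope k2 r) * (k1 - km) * km.
    by rewrite !mulr_ge0// ?subr_ge0// ltW.
  by lra.
apply: (@le_trans _ _ (slope k2 r * (k2 - k1) * (4 * km))).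
  by apply: ler_wpM2r; lra.
nra.
Qed.

Lemma threshold_ge q c a : 0 <= q * a -> q * a <= 1 -> 0 < c -> c <= a ->
  c * h (- 3) <= threshold q a.
Proof.
move=> q0 q1 c0 ca; have [_ _ g1] := gammaP q a.
have := gamma_le3 q0 q1; rewrite le_eqVlt => /predU1P[g3|g3].
  by rewrite /threshold g3 ler_wpM2r// ltW// hN_gt0.
have hg := hN_decr g1 g3; apply: ler_pM => //; first exact: ltW.
  by rewrite ltW// hN_gt0.
exact: ltW.
Qed.

(** Keeping the variation of the threshold as a separate term means that plain continuity of
    [threshold] is enough for that of [zeta]. *)
Lemma zeta_lip R q c : 0 <= q -> q * R <= 1 -> 0 < c ->
  exists2 C, 0 < C & forall y z, c <= y -> y <= z -> z <= R ->
  `|zeta R q y - zeta R q z| <=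
    C * (z - y) + C * `|threshold q y - threshold q z|.
Proof.
move=> q0 qR c0; pose km := c * h (- 3).
have km0 : 0 < km by rewrite mulr_gt0// hN_gt0.
have [R0|R0] := leP R 0; first by exists 1 => // y z cy yz zR; exfalso; lra.
pose C1 := R / (4 * km); pose C2 := R / (4 * km ^+ 2) * R.
have C10 : 0 < C1 by rewrite divr_gt0// mulr_gt0.
have C20 : 0 < C2 by rewrite !mulr_gt0// invr_gt0 mulr_gt0// exprn_gt0.
exists (C1 + C2); first by rewrite addr_gt0.
move=> y z cy yz zR.
have y0 : 0 < y by lra.
have z0 : 0 < z by lra.
have kmle x : c <= x -> x <= R -> km <= threshold q x.
  move=> cx xR; apply: threshold_ge => //; first by rewrite mulr_ge0//; lra.
  by apply: le_trans qR; rewrite ler_wpM2l.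
have ky := kmle y cy (le_trans yz zR); have kz := kmle z (le_trans cy yz) zR.
have k4y := threshold_le4 q y0; have k4z := threshold_le4 q z0.
rewrite !zetaE//; set k1 := threshold q y in ky k4y *.
set k2 := threshold q z in kz k4z *.
have k10 : 0 < k1 by lra.
have k20 : 0 < k2 by lra.
rewrite (Itg_chasles _ yz zR); last exact: itgb_slope.
rewrite -addrA; apply: le_trans (ler_normD _ _) _; apply: lerD.
  rewrite ger0_norm; last by apply: Itg_ge0 => x _; exact: slope_ge0.
  apply: (@le_trans _ _ (C1 * (z - y))); last first.
    by rewrite ler_wpM2r ?subr_ge0// lerDl ltW.
  apply: Itg_le_cst => //; first exact: itgb_slope.
  move=> x /andP[yx xz]; have x0 : 0 < x by lra.
  apply: le_trans (slope_ub k10 x0) _; rewrite /C1.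
  apply: ler_pM; [lra|rewrite invr_ge0; lra|lra|].
  by rewrite lef_pV2 ?posrE; lra.
rewrite -ItgB; [|exact: itgb_slope|exact: itgb_slope].
have i12 : itgb (fun r => slope k1 r - slope k2 r) z R.
  by apply: itgbB; exact: itgb_slope.
have bd x : z <= x <= R ->
    `|slope k1 x - slope k2 x| <= R / (4 * km ^+ 2) * `|k1 - k2|.
  by move=> /andP[zx xR]; apply: slope_lip => //; lra.
apply: (@le_trans _ _ (R / (4 * km ^+ 2) * `|k1 - k2| * (R - z))).
  rewrite ler_norml -mulNr; apply/andP; split.
    apply: Itg_ge_cst => // x /bd; rewrite ler_norml => /andP[]; lra.
  by apply: Itg_le_cst => // x /bd; rewrite ler_norml => /andP[].
rewrite mulrAC ler_wpM2r//.
apply: (@le_trans _ _ C2); last by rewrite lerDr ltW.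
rewrite /C2 ler_wpM2l//; last by lra.
by apply: divr_ge0; [exact: ltW|rewrite mulr_ge0 ?sqr_ge0].
Qed.

End SlopeIntegral.

(** * Continuity and strict decrease of zeta *)

Section Zeta.
Variable K : realType.
Implicit Types (k r p s t q x y z a b c g R M : K).

Lemma continuous_threshold q : continuous (threshold q).
Proof.
have cg : continuous (gamma q).
  move=> a; rewrite /gamma.
  by repeat first [exact: cvg_cst|exact: exprn_continuous|apply: cvgM|apply: cvgD
    |apply: (@continuous_cvg _ _ _ _ _ _ Num.sqrt); first exact: sqrt_continuous].
have -> : threshold q = fun a => a * (gamma q a / (1 + gamma q a * gamma q a) ^+ 2).
  by apply/funext => a; rewrite /threshold hN [gamma q a ^+ 2]expr2.
move=> a; have [_ _ g1] := gammaP q a.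
apply: cvgM; first exact: cvg_id.
apply: cvgM; first exact: cg.
apply: cvgV; first by rewrite gt_eqF// exprn_gt0//; nra.
by apply: cvgM; (apply: cvgD; [exact: cvg_cst|apply: cvgM; exact: cg]).
Qed.

Lemma continuous_zeta R q c : 0 <= q -> q * R <= 1 -> 0 < c ->
  {within `[c, R], continuous (zeta R q)}.
Proof.
move=> q0 qR c0; have [C C0 zC] := zeta_lip q0 qR c0.
apply/subspace_continuousP => x /=; rewrite in_itv/= => /andP[cx xR].
apply/cvgrPdist_le => e e0.
have Ce : 0 < e / (2 * C) by rewrite divr_gt0// mulr_gt0.
have /cvgrPdist_le/(_ _ Ce) kx := @continuous_threshold q x.
have /cvgrPdist_le/(_ _ Ce) Ex : (fun t : K => t) t @[t --> x] --> x by exact: cvg_id.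
rewrite near_withinE; near=> t; rewrite /= in_itv/= => /andP[ct tR].
have h1 : `|x - t| <= e / (2 * C) by near: t.
have h2 : `|threshold q x - threshold q t| <= e / (2 * C) by near: t.
have main : `|zeta R q x - zeta R q t| <=
    C * `|x - t| + C * `|threshold q x - threshold q t|.
  have [xt|/ltW tx] := leP x t.
    rewrite [`|x - t|]ler0_norm ?subr_le0// opprB.
    by have := zC x t cx xt tR.
  rewrite [`|x - t|]ger0_norm ?subr_ge0// distrC [`|threshold q x - _|]distrC.
  by have := zC t x ct tx xR.
apply: le_trans main _.
have -> : e = C * (e / (2 * C)) + C * (e / (2 * C)) by field; rewrite gt_eqF.
by apply: lerD; rewrite ler_pM2l.
Unshelve. all: by end_near. Qed.

Lemma zeta_exists R q c M : 0 <= q -> q * R <= 1 -> 0 < c -> c <= R -> 0 < M ->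
  M <= zeta R q c -> exists2 a, a \in `[c, R[ & zeta R q a = M.
Proof.
move=> q0 qR c0 cR M0 Mc.
have zR : zeta R q R = 0 by rewrite zetaE ?Itgaa//; lra.
have [|a] := @IVT K (zeta R q) c R M cR (continuous_zeta q0 qR c0).
  by rewrite zR ge_min le_max Mc (ltW M0) orbT.
rewrite in_itv/= => /andP[ca aR] aM; exists a => //.
rewrite in_itv/= ca lt_neqAle aR andbT; apply/eqP => aR'.
by move: M0; rewrite -aM aR' zR ltxx.
Qed.

(** A larger multiplier lowers the slope on [z, R], and the part over [y, z], where the slope is at
    least 1, is lost. *)
Let zeta_decr_mono R q y z : 0 < y -> y < z -> z <= R ->
  threshold q y <= threshold q z -> zeta R q z < zeta R q y.
Proof.
move=> y0 yz zR kyz; have z0 : 0 < z by lra.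
have ky := threshold_gt0 q y0; have kz := threshold_gt0 q z0.
rewrite !zetaE// [ltRHS](Itg_chasles _ (ltW yz) zR); last exact: itgb_slope.
apply: (@le_lt_trans _ _ (Itg (slope (threshold q y)) z R)).
  apply: le_Itg; [exact: itgb_slope|exact: itgb_slope|move=> x /andP[zx _]].
  by apply: slope_homo => //; [lra|lra|rewrite ler_pM2r//; lra].
rewrite ltrDr; apply: (@lt_le_trans _ _ (1 * (z - y))); first by lra.
apply: Itg_ge_cst; [lra|exact: itgb_slope|move=> x /andP[yx _]].
have [_ _ g1] := gammaP q y; apply: le_trans g1 _.
by rewrite -slope_threshold//; exact: slope_nd.
Qed.

(* Here [threshold q z] may be below [threshold q y], but by a factor at least
   y / z; by [slope_elastic] the slope on [z, R] then grows by a factor at most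
   z / y, which the loss of the integral over [y, z] outweighs. *)
Let zeta_decr_far R q y z : 0 <= q -> q * R <= 1 ->
  0 < y -> y < z -> z <= R -> 16 / 25 <= q * y ->
  zeta R q z < zeta R q y.
Proof.
move=> q0 qR y0 yz zR qy; have z0 : 0 < z by lra.
have ky := threshold_gt0 q y0; have kz := threshold_gt0 q z0.
have k4y := threshold_le4 q y0; have k4z := threshold_le4 q z0.
have R0 : 0 < R by lra.
have [_ _ g1] := gammaP q y; have sy := slope_threshold q y0.
rewrite !zetaE// [ltRHS](Itg_chasles _ (ltW yz) zR); last exact: itgb_slope.
set A := Itg _ y z; set B := Itg (slope (threshold q y)) z R.
have qz : q * z <= 1 by apply: le_trans qR; rewrite ler_wpM2l.
have kk := mul_threshold_homo q0 y0 (ltW yz) qz.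
have le1 : y * Itg (slope (threshold q z)) z R <= z * B.
  rewrite -!ItgZ; try exact: itgb_slope.
  apply: le_Itg; [by apply: itgbZ; exact: itgb_slope..|move=> x /andP[zx _]].
  have x0 : 0 < x by lra.
  have [kyz|/ltW kzy] := leP (threshold q y) (threshold q z).
    apply: ler_pM => //; [lra|exact: slope_ge0|lra|].
    by apply: slope_homo => //; rewrite ler_pM2r.
  have k4x : 4 * threshold q y <= x by lra.
  have := @slope_elastic K (threshold q z) (threshold q y) x x kz ky x0 x0 k4x.
  rewrite ler_pM2r// => /(_ kzy) E.
  have {}E : slope (threshold q z) x * threshold q z <=
      slope (threshold q y) x * threshold q y by rewrite -(ler_pM2r x0); lra.
  move: E; have s0 := slope_ge0 x ky; have s0' := slope_ge0 x kz.
  rewrite -(ler_pM2l y0) => H; rewrite -(ler_pM2l kz).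
  apply: le_trans (_ : slope (threshold q y) x * (y * threshold q y) <= _); first by lra.
  have := ler_wpM2l s0 kk; lra.
have leA : (z - y) * gamma q y <= A.
  rewrite mulrC; apply: Itg_ge_cst; [lra|exact: itgb_slope|move=> x /andP[yx _]].
  by rewrite -sy; exact: slope_nd.
(* For a fixed multiplier the slope grows at most linearly in r: from gamma at y, it is at most
   gamma R / y on [z, R]. *)
have leB : y * B <= gamma q y * R * (R - z).
  rewrite -ItgZ; last exact: itgb_slope.
  apply: Itg_le_cst => //; first by apply: itgbZ; exact: itgb_slope.
  move=> x /andP[zx xR]; have x0 : 0 < x by lra.
  have := @slope_elastic K (threshold q y) (threshold q y) x y ky ky x0 y0 k4y.
  have yx : threshold q y * y <= threshold q y * x by rewrite ler_pM2l//; lra.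
  move=> /(_ yx); rewrite sy => H.
  have {}H : slope (threshold q y) x * y <= gamma q y * x.
    by rewrite -(ler_pM2l ky); lra.
  apply: (@le_trans _ _ (gamma q y * x)); first by lra.
  by rewrite ler_pM2l//; lra.
have Ry : 16 / 25 * R <= y.
  have := ler_wpM2r (ltW R0) qy.
  by have := ler_wpM2r (ltW y0) qR; lra.
have key : (R - z) * R < y ^+ 2 by nra.
have g0 : 0 < gamma q y by lra.
have B0 : 0 <= B by apply: Itg_ge0 => x _; exact: slope_ge0.
rewrite -(ltr_pM2l y0); apply: le_lt_trans le1 _.
rewrite -subr_gt0.
have -> : y * (A + B) - z * B = y * A - (z - y) * B by ring.
rewrite -(pmulr_rgt0 _ y0).
have zy0 : 0 < z - y by lra.
have h1 := ler_wpM2l (ltW (mulr_gt0 y0 y0)) leA.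
have h2 := ler_wpM2l (ltW zy0) leB.
have : 0 < (z - y) * gamma q y * (y ^+ 2 - (R - z) * R).
  by rewrite !mulr_gt0// subr_gt0.
by lra.
Qed.

(** Two points on either side of 16 / (25 q) are compared through that point, where both regimes
    apply. *)
Lemma zeta_decr R q y z : 0 <= q -> q * R <= 1 ->
  0 < y -> y < z -> z <= R -> zeta R q z < zeta R q y.
Proof.
move=> q0 qR y0 yz zR.
have near x1 x2 : 0 < x1 -> x1 < x2 -> x2 <= R -> q * x2 <= 16 / 25 ->
    zeta R q x2 < zeta R q x1.
  move=> x10 x12 x2R qx; apply: zeta_decr_mono => //.
  by apply: threshold_homo => //; exact: ltW.
have [qz|qz] := leP (q * z) (16 / 25); first exact: near.
have [qy|qy] := leP (16 / 25) (q * y); first exact: zeta_decr_far.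
have q1 : 0 < q.
  by rewrite lt_neqAle q0 andbT; apply/eqP => q1; move: qz; rewrite -q1 mul0r; lra.
pose x := 16 / 25 / q.
have qx : q * x = 16 / 25 by rewrite /x; field; rewrite gt_eqF.
have yx : y < x by rewrite -(ltr_pM2l q1) qx.
have xz : x < z by rewrite -(ltr_pM2l q1) qx.
apply: (@lt_trans _ _ (zeta R q x)).
  by apply: zeta_decr_far => //; rewrite ?qx//; lra.
by apply: near => //; rewrite ?qx//; lra.
Qed.

Lemma zeta_unique R q M y z : 0 <= q -> q * R <= 1 ->
  0 < y -> y <= R -> 0 < z -> z <= R -> zeta R q y = M -> zeta R q z = M -> y = z.
Proof.
move=> q0 qR y0 yR z0 zR yM zM; have [yz|zy|//] := ltgtP y z.
- by have := zeta_decr q0 qR y0 yz zR; rewrite yM zM ltxx.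
- by have := zeta_decr q0 qR z0 zy yR; rewrite yM zM ltxx.
Qed.

(** The threshold is at most a / 4, its value at q = 0, and a smaller multiplier gives a larger
    slope. This places a_* in [a_M, R[. *)
Lemma zeta0_le R q a : 0 < a -> a <= R -> zeta R 0 a <= zeta R q a.
Proof.
move=> a0 aR; have k0 := threshold_gt0 0 a0; have k1 := threshold_gt0 q a0.
rewrite (zetaE R 0 a0) (zetaE R q a0).
apply: le_Itg (itgb_slope a R k0) (itgb_slope a R k1) _.
move=> x /andP[ax _]; have x0 : 0 < x by lra.
apply: slope_homo => //.
rewrite ler_pM2r; last by lra.
rewrite threshold0; have := threshold_le4 q a0; lra.
Qed.

End Zeta.

(** Fundamental theorem for a monotone, possibly discontinuous m: the increments of F and of the
    primitive of m lie between the same bounds, hence differ by at most (m y - m x) (y - x), and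
    [le_telescoping] applies. *)
Lemma mono_Itg (K : realType) (m F : K -> K) (a b : K) : a <= b ->
  (forall x y, a <= x -> x <= y -> y <= b -> m x <= m y) ->
  (forall x y, a <= x -> x <= y -> y <= b ->
     m x * (y - x) <= F y - F x <= m y * (y - x)) ->
  itgb m a b /\ F b - F a = Itg m a b.
Proof.
move=> ab mnd Fm.
have mi : itgb m a b.
  by apply: itgb_nd => x y; rewrite !in_itv/= => /andP[ax _] /andP[_ yb] xy; exact: mnd.
have bd x y : a <= x -> x <= y -> y <= b ->
    m x * (y - x) <= Itg m a y - Itg m a x <= m y * (y - x).
  move=> ax xy yb; have ay : a <= y by lra.
  have miy : itgb m a y by apply: itgbS mi _ _.
  have mixy : itgb m x y by apply: itgbS mi _ _.
  rewrite (Itg_chasles miy ax xy) addrAC subrr add0r; apply/andP; split.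
    by apply: Itg_ge_cst => // s /andP[? ?]; apply: mnd; lra.
  by apply: Itg_le_cst => // s /andP[? ?]; apply: mnd; lra.
split => //; apply/eqP; rewrite eq_le; apply/andP; split.
- have : F a - Itg m a a >= F b - Itg m a b; last by rewrite Itgaa; lra.
  rewrite -lerN2; apply: (@le_telescoping _ _ _ 1 (fun x => - (F x - Itg m a x)) m) => //.
  move=> x y ax xy yb; have := bd _ _ ax xy yb; have := Fm _ _ ax xy yb.
  by rewrite mul1r; lra.
- have : F a - Itg m a a <= F b - Itg m a b; last by rewrite Itgaa; lra.
  apply: (@le_telescoping _ _ _ 1 (fun x => F x - Itg m a x) m) => //.
  move=> x y ax xy yb; have := bd _ _ ax xy yb; have := Fm _ _ ax xy yb.
  by rewrite mul1r; lra.
Qed.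

(** * Profiles and their right slope *)

Section Profile.
Variables (K : realType) (R M q : K) (v : K -> K).
Hypotheses (R0 : 0 < R) (q0 : 0 <= q) (pv : profiles R M q v).
Implicit Types r s x y z : K.

Let w r := v r - q / 2 * r ^+ 2.

Let in0R r : 0 <= r -> r <= R -> r \in `[0, R].
Proof. by move=> r0 rR; rewrite in_itv/= r0. Qed.

Lemma profile_range r : 0 <= r -> r <= R -> 0 <= v r <= M.
Proof.
move=> r0 rR; case: pv => /(_ r (in0R r0 rR)) + _ _.
by rewrite in_itv.
Qed.

Lemma profile_anti x y : 0 <= x -> x <= y -> y <= R -> w y <= w x.
Proof.
move=> x0 xy yR; case: pv => _ + _; apply => //; apply: in0R; lra.
Qed.

Lemma profile_chord x y z : 0 <= x -> x < y -> y < z -> z <= R ->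
  (w x - w y) * (z - y) <= (w y - w z) * (y - x).
Proof.
move=> x0 xy yz zR; case: pv => _ _ cv.
pose t := (z - y) / (z - x).
have zx : 0 < z - x by lra.
have t0 : 0 <= t by rewrite divr_ge0; lra.
have t1 : t <= 1 by rewrite ler_pdivrMr// mul1r; lra.
have tE : t * (z - x) = z - y by rewrite /t mulfVK// gt_eqF.
have xR : x \in `[0, R]%classic by rewrite inE; apply: in0R; lra.
have zR' : z \in `[0, R]%classic by rewrite inE; apply: in0R; lra.
have cw : concave_function `[0, R]%classic w by [].
have := cw (Itv01 t0 t1) x z xR zR'.
set c := (X in _ <= w X).
have -> : c = y by change (t * x + (1 - t) * z = y); lra.
rewrite !convRE /= /unstable.onem.
rewrite -/(w x) -/(w y) -/(w z) => H.
have := ler_wpM2r (ltW zx) H.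
have -> : (t * w x + (1 - t) * w z) * (z - x) =
  t * (z - x) * w x + (z - x - t * (z - x)) * w z by ring.
by rewrite tE; lra.
Qed.

(* By concavity this infimum is minus the right derivative of w. *)
Definition profile_slope r :=
  inf [set x | exists s, r < s <= R /\ x = (w r - w s) / (s - r)].

Let m := profile_slope.

Let slopes_lb r : 0 <= r -> forall b, (forall s, r < s <= R -> b * (s - r) <= w r - w s) ->
  lbound [set x | exists s, r < s <= R /\ x = (w r - w s) / (s - r)] b.
Proof.
move=> r0 b H x [s [rs ->]]; have := H s rs; case/andP: rs => rs sR H'.
by rewrite ler_pdivlMr// subr_gt0.
Qed.

Let slopes_n0 r : r < R ->
  [set x | exists s, r < s <= R /\ x = (w r - w s) / (s - r)] !=set0.
Proof. by move=> rR; exists ((w r - w R) / (R - r)); exists R; rewrite rR lexx. Qed.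

Lemma profile_slope_ge0 r : 0 <= r -> r < R -> 0 <= m r.
Proof.
move=> r0 rR; apply: lb_le_inf; first exact: slopes_n0.
apply: slopes_lb => // s /andP[rs sR]; rewrite mul0r subr_ge0.
by apply: profile_anti => //; exact: ltW.
Qed.

Lemma profile_slope_le x y : 0 <= x -> x <= y -> y <= R ->
  m x * (y - x) <= w x - w y.
Proof.
move=> x0; rewrite le_eqVlt => /predU1P[->|xy yR]; first by rewrite !subrr mulr0.
rewrite -ler_pdivlMr ?subr_gt0//; apply: ge_inf.
  exists 0; apply: slopes_lb => // s /andP[rs sR]; rewrite mul0r subr_ge0.
  by apply: profile_anti => //; exact: ltW.
by exists y; rewrite xy yR.
Qed.

(** The strict bound y < R matters: at R the set of difference quotients is empty. *)
Lemma profile_slope_ge x y : 0 <= x -> x <= y -> y < R ->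
  w x - w y <= m y * (y - x).
Proof.
move=> x0; rewrite le_eqVlt => /predU1P[->|xy yR]; first by rewrite !subrr mulr0.
rewrite -ler_pdivrMr ?subr_gt0//; apply: lb_le_inf; first exact: slopes_n0.
have y0 : 0 <= y by lra.
apply: slopes_lb => // s /andP[ys sR].
rewrite mulrAC ler_pdivrMr ?subr_gt0//.
exact: profile_chord.
Qed.

Lemma profile_slope_nd x y : 0 <= x -> x <= y -> y < R -> m x <= m y.
Proof.
move=> x0; rewrite le_eqVlt => /predU1P[->//|xy yR].
have yx : 0 < y - x by lra.
rewrite -(ler_pM2r yx).
apply: le_trans (profile_slope_le x0 (ltW xy) (ltW yR)) _.
exact: profile_slope_ge x0 (ltW xy) yR.
Qed.

Lemma profile_Itg x y : 0 <= x -> x <= y -> y < R ->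
  itgb m x y /\ w x - w y = Itg m x y.
Proof.
move=> x0 xy yR.
have [] := @mono_Itg K m (fun r => - w r) x y xy.
- by move=> s t *; apply: profile_slope_nd; lra.
- move=> s t xs st ty.
  have s0 : 0 <= s by lra.
  have tR : t < R by lra.
  have := profile_slope_le s0 st (ltW tR).
  have := profile_slope_ge s0 st tR; lra.
by move=> ? E; split => //; lra.
Qed.

(** Lebesgue differentiation applied to the primitive of m. One stays below Y < R because m may be
    unbounded near R. *)
Lemma profile_derive Y : 0 < Y -> Y < R ->
  {ae (@lebesgue_measure K), forall r, 0 < r < Y -> derive1 v r = q * r - m r}.
Proof.
move=> Y0 YR; have [mi _] := profile_Itg (lexx 0) (ltW Y0) YR.
pose g := m \_ `[0, Y].
have gi y : (@lebesgue_measure K).-integrable `[0, y] (EFin \o g).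
  have [gm _] : (@lebesgue_measure K).-integrable [set: K] (EFin \o g) /\ True.
    split => //; rewrite /g -restrict_EFin.
    by have := mi; rewrite /itgb integrable_mkcond.
  exact: integrableS gm.
have lg := integrable_locally (measurable_itv _) mi.
have FT := @FTC1 K g (BLeft 0) gi lg.
move: FT; apply: filterS; first exact: (ae_filter_ringOfSetsType (@lebesgue_measure K)).
move=> r Fr /andP[r0 rY].
have {Fr} [dF F'] : derivable (fun x => Itg g 0 x) r 1 /\
    derive1 (fun x => Itg g 0 x) r = m r.
  have [|dF F'] := Fr; first by rewrite lte_fin.
  split => //; rewrite F' /g patchE mem_set//= in_itv/=.
  by rewrite !ltW.
have gE x : 0 <= x -> x <= Y -> Itg g 0 x = w 0 - w x.
  move=> x0 xY; have xR : x < R by lra.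
  have [_ ->] := profile_Itg (lexx 0) x0 xR; apply: eq_Itg => s /andP[s0 sx].
  rewrite /g patchE mem_set//= in_itv/= s0; lra.
have near_v : \near r, w 0 + q / 2 * r ^+ 2 - Itg g 0 r = v r.
  near=> x; rewrite gE; [by rewrite /w; lra| |].
    by apply/ltW; near: x; exact: lt_nbhsr.
  by apply/ltW; near: x; exact: lt_nbhsl.
have isF : is_derive r 1 (fun x => Itg g 0 x) (m r).
  by apply: DeriveDef; [exact: dF|rewrite -derive1E; exact: F'].
have D := near_eq_is_derive near_v.
have isP : is_derive r 1 (fun x => w 0 + q / 2 * x ^+ 2) (q * r).
  apply: is_derive_eq.
  by rewrite /GRing.scale/= !mulr1; field.
have isv : is_derive r 1 v (q * r - m r) by apply: D; exact: is_deriveB.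
by rewrite derive1E derive_val.
Unshelve. all: by end_near. Qed.

End Profile.

(** * The resistance of a profile bounded from below *)

Section Resistance.
Variable K : realType.
Implicit Types (a b c d q M R x y : K) (f g p v : K -> K).

Lemma continuous_drag : continuous (@drag K).
Proof.
move=> x; rewrite /drag; apply: cvgV; first by rewrite gt_eqF//; nra.
by apply: cvgD; [exact: cvg_cst|exact: exprn_continuous].
Qed.

Lemma eq_Itg_oo f g a b : itgb f a b -> itgb g a b ->
  (forall x, a < x < b -> f x = g x) -> Itg f a b = Itg g a b.
Proof.
move=> /integrableP[/measurable_EFinP mf _] /integrableP[/measurable_EFinP mg _] fg.
rewrite /Itg /Rintegral (@eq_integral_itv_bounded K a b g f true false)//.
- by apply: measurable_funS mf => //; apply: subset_itvW.
- by apply: measurable_funS mg => //; apply: subset_itvW.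
Qed.

Lemma itgb_drag p a b : measurable_fun `]a, b[ p ->
  itgb (fun r => r * drag (p r)) a b.
Proof.
move=> mp; apply: (@itgb_bounded K _ a b (`|a| + `|b|)).
  apply: (@measurable_fun_itv_cc K a b false true).
  apply: measurable_funM => //.
  apply: (measurableT_comp _ mp).
  by apply: continuous_measurable_fun; exact: continuous_drag.
move=> x /andP[ax xb].
have d0 := drag_gt0 (p x); have d1 := drag_le1 (p x).
rewrite normrM (gtr0_norm d0).
apply: (@le_trans _ _ (`|x| * 1)); first by rewrite ler_wpM2l.
have := ler_norm (- a); rewrite normrN; have := ler_norm b.
have := normr_ge0 a; have := normr_ge0 b.
by rewrite mulr1 ler_norml => *; apply/andP; split; lra.
Qed.

(* No measurability of f is assumed: the integral of a nonnegative function is the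
   supremum of those of the simple functions below it. *)
Lemma Itg_le_integral f g a b c d :
  (forall x, c <= x <= d -> 0 <= f x) -> c <= a -> b <= d ->
  itgb g a b -> (forall x, a <= x <= b -> 0 <= g x) ->
  {ae (@lebesgue_measure K), forall x, a < x < b -> f x = g x} ->
  ((Itg g a b)%:E <= \int[lebesgue_measure]_(x in `[c, d]) (f x)%:E)%E.
Proof.
move=> f0 ca bd gi g0 [N [mN N0 fgN]].
pose A := `]a, b[%classic `\` N.
have -> : ((Itg g a b)%:E = \int[lebesgue_measure]_(x in A) (g x)%:E)%E.
  rewrite /A -negligible_integral//; last first.
    by apply: integrableS gi => //; apply: subset_itvW.
  rewrite -(@integral_itv_bndoo K a b _ true false).
    by rewrite /Itg /Rintegral fineK//; exact: integrable_fin_num.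
  have /integrableP[mg _] := gi.
  by apply: measurable_funS mg => //; apply: subset_itvW.
rewrite !ge0_integralE; last 2 first.
- by move=> x /=; rewrite in_itv/= lee_fin; exact: f0.
- move=> x [/=]; rewrite in_itv/= lee_fin => /andP[ax xb] _.
  by apply: g0; rewrite !ltW.
apply: le_ereal_sup => _ [k /= kg <-]; exists k => // x.
apply: le_trans (kg x) _; rewrite !patchE; case: ifPn => [|_].
  rewrite inE => -[/=]; rewrite in_itv/= => /andP[ax xb] xN.
  rewrite mem_set/=; last by rewrite in_itv/=; apply/andP; split; lra.
  rewrite lee_fin; apply: contrapT => fg; apply: xN; apply: fgN => /= fgx.
  by apply: fg; rewrite fgx ?lexx// ax.
case: ifPn => //; rewrite inE/= in_itv/= lee_fin; exact: f0.
Qed.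

(** Agrees almost everywhere with the integrand of [resistance], but is measurable by construction,
    since the right slope is monotone. *)
Definition profile_drag R q v r := r * drag (q * r - profile_slope R q v r).

Lemma itgb_profile_drag R M q v x y : 0 < R -> profiles R M q v ->
  0 <= x -> y <= R -> itgb (profile_drag R q v) x y.
Proof.
move=> R0 pv x0 yR; apply: itgb_drag; apply: measurable_funB.
  by apply: measurable_funM.
apply: measurable_mono_itv => s t; rewrite !in_itv/= => /andP[xs _] /andP[_ ty] st.
by apply: (profile_slope_nd pv) => //; lra.
Qed.

Lemma profile_drag_ge0 R q v x : 0 <= x -> 0 <= profile_drag R q v x <= x.
Proof.
move=> x0; have := drag_gt0 (q * x - profile_slope R q v x).
have := drag_le1 (q * x - profile_slope R q v x).
by rewrite /profile_drag => ? ?; apply/andP; split; nra.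
Qed.

Let resistance_ge_lt R M q v Y : 0 < R -> profiles R M q v -> 0 < Y -> Y < R ->
  ((Itg (profile_drag R q v) 0 Y)%:E <= resistance R v)%E.
Proof.
move=> R0 pv Y0 YR; apply: Itg_le_integral => //.
- by move=> x /andP[x0 xR]; rewrite divr_ge0//; nra.
- exact: ltW.
- by apply: itgb_profile_drag pv _ _ => //; exact: ltW.
- by move=> x /andP[x0 _]; have /andP[] := profile_drag_ge0 R q v x0.
have := profile_derive pv Y0 YR.
apply: filterS; first exact: (ae_filter_ringOfSetsType (@lebesgue_measure K)).
move=> x H /H.
by rewrite /profile_drag /drag => ->.
Qed.

(** The inequality is all that optimality and uniqueness ask of a competitor; for the optimal
    profile the resistance is computed directly. The tail beyond Y contributes at most R (R - Y). *)
Lemma resistance_ge R M q v : 0 < R -> profiles R M q v ->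
  ((Itg (profile_drag R q v) 0 R)%:E <= resistance R v)%E.
Proof.
move=> R0 pv; apply/lee_addgt0Pr => e e0.
have [Y [Y0 YR eY]] : exists Y, [/\ 0 < Y, Y < R & R * (R - Y) <= e].
  have m0 : 0 < Num.min (R / 2) (e / R) by rewrite lt_min !divr_gt0.
  exists (R - Num.min (R / 2) (e / R)).
  have m1 : Num.min (R / 2) (e / R) <= R / 2 by rewrite ge_min lexx.
  have m2 : Num.min (R / 2) (e / R) <= e / R by rewrite ge_min lexx orbT.
  split; [lra|lra|].
  rewrite opprB addrC subrK mulrC -ler_pdivlMr//.
apply: le_trans (leeD (resistance_ge_lt R0 pv Y0 YR) (lexx _)).
have i0 := itgb_profile_drag R0 pv (lexx 0) (lexx R).
rewrite -EFinD lee_fin (Itg_chasles i0 (ltW Y0) (ltW YR)) lerD2l.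
apply: le_trans eY; apply: Itg_le_cst; first exact: ltW.
  by apply: itgbS i0 _ _ => //; exact: ltW.
move=> x /andP[Yx xR]; have x0 : 0 <= x by lra.
by have /andP[_] := profile_drag_ge0 R q v x0; move=> /le_trans; apply.
Qed.

End Resistance.

(** * Left of the turning point: the pairing of r with x - r *)

Section Reflection.
Variable K : realType.
Implicit Types (r s x q R M : K).

Lemma sqr_le_abs (x y : K) : - y <= x -> x <= y -> x ^+ 2 <= y ^+ 2.
Proof. by move=> h1 h2; nra. Qed.

(** Alone, r loses when m1 > 2 q r, because its slope becomes steeper than q r; the loss is
    outweighed by the gain at the heavier partner s, thanks to m1 <= m2 <= q (r + s). If m1 <= 2 q
    r, neither slope becomes steeper. *)
Lemma drag_pair_strict q r s (m1 m2 : K) : 0 <= q -> q * (r + s) <= 1 -> 0 <= r -> r < s ->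
  0 <= m1 -> m1 <= m2 -> m2 <= q * (r + s) -> 0 < m2 ->
  r * drag (q * r) + s * drag (q * s) <
  r * drag (q * r - m1) + s * drag (q * s - m2).
Proof.
move=> q0 qx r0 rs m10 m12 m2x m20; have s0 : 0 < s by lra.
have q1 : 0 < q.
  by rewrite lt_neqAle q0 andbT; apply/eqP => q1; move: m2x; rewrite -q1 mul0r; lra.
set B := q * r in m2x *; set D := q * s in m2x *.
have BD : B < D by rewrite /B /D ltr_pM2l.
have rD : r * D = s * B by rewrite /D /B; ring.
have B0 : 0 <= B by rewrite mulr_ge0.
have BD1 : B + D <= 1 by rewrite /B /D; lra.
have {}m2x : m2 <= B + D by rewrite /B /D; lra.
have [m1B|m1B] := leP m1 (2 * B).
  have h1 : drag B <= drag (B - m1) by apply: le_drag; apply: sqr_le_abs; lra.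
  have h2 : drag D < drag (D - m2) by apply: lt_drag; nra.
  have := ler_wpM2l r0 h1; have := h2; rewrite -(ltr_pM2l s0); lra.
have dC : drag (B - m1) = drag (m1 - B) by rewrite /drag -sqrrN opprB.
(* If D - m1 <= B, the new slopes are at worst D at r and B at s: the old ones exchanged, so the
   larger weight meets the smaller slope. *)
have [AB|AB] := leP (D - m1) B.
  have h1 : drag D <= drag (B - m1).
    by rewrite dC; apply: le_drag; apply: sqr_le_abs; lra.
  have h2 : drag B <= drag (D - m2) by apply: le_drag; apply: sqr_le_abs; lra.
  have h3 : drag D < drag B by apply: lt_drag; nra.
  have := ler_wpM2l r0 h1; have := ler_wpM2l (ltW s0) h2.
  have : 0 < (s - r) * (drag B - drag D) by rewrite mulr_gt0; lra.
  lra.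
(* As m2 - D <= B < D - m1, the worst case is m2 = m1. *)
have h2 : drag (D - m1) <= drag (D - m2).
  by apply: le_drag; apply: sqr_le_abs; lra.
have := ler_wpM2l (ltW s0) h2; rewrite dC.
suff : r * drag B + s * drag D < r * drag (m1 - B) + s * drag (D - m1) by lra.
set A := D - m1 in AB *; set C := m1 - B.
have D0 : 0 < D by lra.
have DE : D = A + B + C by rewrite /A /C; ring.
have AC : [/\ 0 <= A, B < C, A < D & C <= D] by move: AB; rewrite /A /C => AB; split; lra.
case: AC => A0 BC AD CD.
rewrite -(ltr_pM2r D0).
(* Since r : s = B : D, the weights become B and D. What remains comes down to 4 B C < D^2, which
   holds because A > B gives D > 2 B + C. *)
suff : B * drag B + D * drag D < B * drag C + D * drag A.
  have -> : (r * drag B + s * drag D) * D = s * (B * drag B + D * drag D).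
    by rewrite mulrDl mulrAC rD; ring.
  have -> : (r * drag C + s * drag A) * D = s * (B * drag C + D * drag A).
    by rewrite mulrDl mulrAC rD; ring.
  by move=> H; rewrite ltr_pM2l.
have pA : 0 < 1 + A ^+ 2 by nra.
have pB : 0 < 1 + B ^+ 2 by nra.
have pC : 0 < 1 + C ^+ 2 by nra.
have pD : 0 < 1 + D ^+ 2 by nra.
rewrite -subr_gt0 /drag.
have -> : B * (1 + C ^+ 2)^-1 + D * (1 + A ^+ 2)^-1 - (B * (1 + B ^+ 2)^-1 + D * (1 + D ^+ 2)^-1) =
  (B + C) * (D * (D + A) * ((1 + B ^+ 2) * (1 + C ^+ 2))
    - B * (C - B) * ((1 + A ^+ 2) * (1 + D ^+ 2))) /
  ((1 + A ^+ 2) * (1 + B ^+ 2) * ((1 + C ^+ 2) * (1 + D ^+ 2))).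
  rewrite [in RHS]mulrBr.
  have -> : (B + C) * (D * (D + A) * ((1 + B ^+ 2) * (1 + C ^+ 2))) =
    D * (D ^+ 2 - A ^+ 2) * ((1 + B ^+ 2) * (1 + C ^+ 2)).
    by rewrite DE; ring.
  by field; rewrite !gt_eqF.
rewrite divr_gt0//; last by rewrite !mulr_gt0.
have D1 : D <= 1 by lra.
have C0 : 0 < C by lra.
apply: mulr_gt0; first by lra.
have lhs : D * D <= D * (D + A) * ((1 + B ^+ 2) * (1 + C ^+ 2)).
  have e1 : 1 <= (1 + B ^+ 2) * (1 + C ^+ 2).
    by have := mulr_ge0 (sqr_ge0 B) (sqr_ge0 C); have := sqr_ge0 B; have := sqr_ge0 C; lra.
  have e2 : D * D <= D * (D + A) by rewrite ler_pM2l//; lra.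
  by have := ler_wpM2l (le_trans (ltW (mulr_gt0 D0 D0)) e2) e1; lra.
have rhs : B * (C - B) * ((1 + A ^+ 2) * (1 + D ^+ 2)) <= B * C * 4.
  have e1 : (1 + A ^+ 2) * (1 + D ^+ 2) <= 2 * 2 by apply: ler_pM; nra.
  have e2 : B * (C - B) <= B * C by rewrite ler_wpM2l//; lra.
  have e3 : 0 <= B * (C - B) by rewrite mulr_ge0//; lra.
  by have := ler_wpM2l e3 e1; lra.
have : B * C * 4 < D * D.
  have : (2 * B + C) * (2 * B + C) < D * D by apply: ltr_pM; lra.
  by have := mulr_ge0 B0 (ltW C0); have := mulr_ge0 B0 B0; have := mulr_gt0 C0 C0; lra.
lra.
Qed.

Lemma drag_pair q r s (m1 m2 : K) : 0 <= q -> q * (r + s) <= 1 -> 0 <= r -> r <= s ->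
  0 <= m1 -> m1 <= m2 -> m2 <= q * (r + s) ->
  r * drag (q * r) + s * drag (q * s) <=
  r * drag (q * r - m1) + s * drag (q * s - m2).
Proof.
move=> q0 qx r0; rewrite le_eqVlt => /predU1P[<-|rs] m10 m12 m2x.
  apply: lerD; apply: ler_wpM2l => //; apply: le_drag; apply: sqr_le_abs; lra.
have [m20|m20] := ltP 0 m2; first exact/ltW/drag_pair_strict.
have -> : m2 = 0 by lra.
have -> : m1 = 0 by lra.
by rewrite !subr0.
Qed.

Lemma left_estimate q x (m : K -> K) : 0 <= q -> q * x <= 1 -> 0 < x ->
  (forall r s, 0 <= r -> r <= s -> s < x -> m r <= m s) ->
  (forall r, 0 <= r -> r < x -> 0 <= m r <= q * x) ->
  Itg (fun r => r * drag (q * r)) 0 x <= Itg (fun r => r * drag (q * r - m r)) 0 x /\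
  (Itg (fun r => r * drag (q * r - m r)) 0 x <= Itg (fun r => r * drag (q * r)) 0 x ->
   forall r, 0 <= r -> r < x -> m r = 0).
Proof.
move=> q0 qx x0 mnd mb.
(* Nothing is known of m at x, the mirror image of 0; the value 0 there makes D vanish at 0. *)
pose m' r := if r < x then m r else 0.
pose f r := r * drag (q * r - m' r); pose g r := r * drag (q * r).
have mm (p : K -> K) : {in `]0, x[ &, nondecreasing_fun p} ->
    itgb (fun r => r * drag (q * r - p r)) 0 x.
  move=> pnd; apply: itgb_drag; apply: measurable_funB; first exact: measurable_funM.
  exact: measurable_mono_itv.
have mi : itgb (fun r => r * drag (q * r - m r)) 0 x.
  apply: mm => r s; rewrite !in_itv/= => /andP[r0 _] /andP[_ sx] rs.
  by apply: mnd => //; exact: ltW.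
have fi : itgb f 0 x.
  apply: mm => r s; rewrite !in_itv/= => /andP[r0 rx] /andP[_ sx] rs.
  by rewrite /m' rx sx; apply: mnd => //; exact: ltW.
have gi : itgb g 0 x.
  by apply: itgb_drag; apply: measurable_funM.
have -> : Itg (fun r => r * drag (q * r - m r)) 0 x = Itg f 0 x.
  by apply: eq_Itg_oo => // r /andP[_ rx]; rewrite /f /m' rx.
have f0 r : 0 <= r <= x -> 0 <= f r.
  by move=> /andP[r0 _]; rewrite mulr_ge0// ltW// drag_gt0.
have g0 r : 0 <= r <= x -> 0 <= g r.
  by move=> /andP[r0 _]; rewrite mulr_ge0// ltW// drag_gt0.
have [fi' fE] := Itg_refl f0 fi; have [gi' gE] := Itg_refl g0 gi.
pose D r := (f r + f (x - r)) - (g r + g (x - r)).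
have Di : itgb D 0 x by apply: itgbB; exact: itgbD.
have DE : Itg D 0 x = 2 * (Itg f 0 x - Itg g 0 x).
  rewrite /D ItgB; [|exact: itgbD|exact: itgbD].
  by rewrite !ItgD// fE gE; ring.
have half r : 0 <= r -> r <= x - r -> 0 <= D r.
  move=> r0 rx; rewrite /D subr_ge0 /f /g.
  have [->|rn0] := eqVneq r 0.
    by rewrite /m' subr0 ltxx !mul0r !add0r subr0.
  have {}r0 : 0 < r by rewrite lt_neqAle eq_sym rn0.
  have rx' : r < x by lra.
  have xrx : x - r < x by lra.
  have xr0 : 0 <= x - r by lra.
  rewrite /m' rx' xrx; apply: drag_pair => //.
  - by rewrite subrKC.
  - exact: ltW.
  - by have /andP[] := mb r (ltW r0) rx'.
  - by apply: mnd => //; exact: ltW.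
  - by rewrite subrKC; have /andP[] := mb (x - r) xr0 xrx.
have Dsym r : D (x - r) = D r by rewrite /D subKr; ring.
have D0 r : 0 <= r <= x -> 0 <= D r.
  move=> /andP[r0 rx]; have [h1|/ltW h1] := leP r (x - r); first exact: half.
  by rewrite -Dsym; apply: half; rewrite ?subKr; lra.
split.
  by have := Itg_ge0 D0; rewrite DE; lra.
move=> fg t t0 tx; apply/eqP; rewrite eq_le; apply/andP; split; last first.
  by have /andP[] := mb t t0 tx.
rewrite leNgt; apply/negP => mt.
(* For r < u the partner x - r exceeds t, so m is positive there and the pair is strictly worse. *)
pose u := Num.min (x - t) (x / 2).
have u0 : 0 < u by rewrite lt_min; apply/andP; split; lra.
have u1 : u <= x - t by rewrite ge_min lexx.
have u2 : u <= x / 2 by rewrite ge_min lexx orbT.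
have : 0 < Itg D 0 x.
  apply: (@Itg_gt0 K D 0 x 0 u) => //; first by lra.
  move=> r /andP[r0 ru]; rewrite /D subr_gt0 /f /g.
  have rx : r < x by lra.
  have xrx : x - r < x by lra.
  have xr0 : 0 <= x - r by lra.
  rewrite /m' rx xrx; apply: drag_pair_strict => //.
  - by rewrite subrKC.
  - exact: ltW.
  - by lra.
  - by have /andP[] := mb r (ltW r0) rx.
  - by apply: mnd; lra.
  - by rewrite subrKC; have /andP[] := mb (x - r) xr0 xrx.
  - by apply: lt_le_trans mt _; apply: mnd; lra.
by rewrite DE; lra.
Qed.

End Reflection.

(** The arithmetic of [dual_step_right] with the integrals as free variables: d stands for twice the
    change of multiplier, e for an error proportional to the length of the step. *)
Lemma dual_bound_combine (K : realFieldType) (fy fz P L L2 L3 S1 S2 d M e : K) :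
  0 <= d -> fz - fy = (P - L) + (L2 - L3) + d * M ->
  L - d * S1 <= P -> L3 - d * S2 <= L2 -> S1 + S2 <= M + e -> fy - fz <= d * e.
Proof. by move=> d0 E h1 h2 h3; have := ler_wpM2l d0 h3; lra. Qed.

(** * The dual bound is smallest at the optimal turning point *)

Section DualBound.
Variables (K : realType) (R M q a : K).
Hypotheses (q0 : 0 <= q) (qR : q * R <= 1).
Hypotheses (a0 : 0 < a) (aR : a < R) (aM : zeta R q a = M).
Implicit Types (k r s x y z p : K).

Local Notation kap := (threshold q).

(** Envelope inequality: as an infimum of functions affine in k, [lag] is concave in k, with
    supergradient twice the slope. *)
Lemma lag_envelope k1 k2 r : 0 < k1 -> 0 < k2 -> 0 < r ->
  lag k1 r <= lag k2 r + 2 * (k1 - k2) * slope k2 r.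
Proof.
move=> k10 k20 r0; have := lag_le k10 r0 (slope_ge0 r k20).
by rewrite [lag k2 r]/lag; lra.
Qed.

Lemma lag_homo k1 k2 r : 0 < k1 -> k1 <= k2 -> 0 < r -> lag k1 r <= lag k2 r.
Proof.
move=> k10 k12 r0; have k20 : 0 < k2 by lra.
have := lag_envelope k10 k20 r0.
have : 0 <= (k2 - k1) * slope k2 r by apply: mulr_ge0; [lra|exact: slope_ge0].
lra.
Qed.

Lemma lag0 k : 0 < k -> lag k 0 = 0.
Proof. by move=> k0; rewrite /lag slope_small; lra. Qed.

Lemma lag_le_id k r : 0 < k -> 0 < r -> lag k r <= r.
Proof.
move=> k0 r0; have := lag_le k0 r0 (lexx 0).
by rewrite /drag expr0n addr0 invr1; lra.
Qed.

Definition parabola_drag r := r * drag (q * r).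

Lemma itgb_parabola x y : itgb parabola_drag x y.
Proof. by apply: itgb_drag; exact: measurable_funM. Qed.

Definition dual_bound x k :=
  Itg parabola_drag 0 x + Itg (lag k) x R - 2 * k * M.

Let R0 : 0 < R. Proof. exact: lt_trans a0 aR. Qed.

Let zeta_ltM x : a <= x -> x <= R -> zeta R q x <= M.
Proof.
rewrite le_eqVlt -aM => /predU1P[->//|ax xR].
by apply/ltW/zeta_decr.
Qed.

Let zeta_gtM x : 0 < x -> x <= a -> M <= zeta R q x.
Proof.
rewrite le_eqVlt -aM => x0 /predU1P[->//|ax].
by apply/ltW/zeta_decr => //; exact: ltW.
Qed.

Let slope_bd km k x y : 0 < km -> km <= k -> 0 <= x -> x <= y -> y <= R ->
  Itg (slope k) x y <= R / (4 * km) * (y - x).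
Proof.
move=> km0 kmk x0 xy yR; have k0 : 0 < k by lra.
apply: Itg_le_cst => //; first exact: itgb_slope.
move=> r /andP[xr ry]; have [r0|r0] := ltP 0 r; last first.
  rewrite slope_small; last by lra.
  by rewrite divr_ge0//; lra.
apply: le_trans (slope_ub k0 r0) _.
apply: ler_pM; [lra|rewrite invr_ge0; lra|lra|].
by rewrite lef_pV2 ?posrE; lra.
Qed.

Let dual_diff y z k1 k2 : 0 <= y -> y <= z -> z <= R -> 0 < k1 -> 0 < k2 ->
  dual_bound z k2 - dual_bound y k1 =
  (Itg parabola_drag y z - Itg (lag k1) y z) + (Itg (lag k2) z R - Itg (lag k1) z R)
  + 2 * (k1 - k2) * M.
Proof.
move=> y0 yz zR k10 k20; rewrite /dual_bound.
rewrite [in LHS](Itg_chasles (itgb_parabola 0 z) y0 yz).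
rewrite [in LHS](Itg_chasles (itgb_lag y R k10) yz zR); ring.
Qed.

(** The new minimum k2 is attained at some p in ]y, z]. As p >= a, the slope with multiplier k2 has
    integral [zeta R q p] <= M over [p, R]; the piece [y, p] costs O(z - y). Multiplied by k1 - k2,
    this is an error of the form that [le_telescoping] absorbs. *)
Let dual_step_right y z p km k1 k2 : a <= y -> y < p -> p <= z -> z <= R ->
  0 < km -> km <= k2 -> k2 <= k1 -> k2 = kap p ->
  (forall t, a <= t <= z -> k2 <= kap t) ->
  dual_bound y k1 - dual_bound z k2 <=
    2 * (k1 - k2) * (R / (4 * km) * (z - y)).
Proof.
have a0' := a0; move=> ay yp pz zR km0 kk2 k21 k2E kmin.
have y0 : 0 < y by lra.
have yz : y <= z by lra.
have z0 : 0 < z by lra.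
have k20 : 0 < k2 by lra.
have k10 : 0 < k1 by lra.
have k12 : 0 <= 2 * (k1 - k2) by lra.
have E : a <= p by lra.
have pR : p <= R by lra.
have h3 : Itg (slope k2) y z + Itg (slope k2) z R <= M + R / (4 * km) * (z - y).
  rewrite -(Itg_chasles (itgb_slope y R k20) yz zR).
  rewrite (Itg_chasles (itgb_slope y R k20) (ltW yp) pR) addrC.
  apply: lerD.
    by rewrite k2E -(zetaE R q (lt_le_trans a0 E)); exact: zeta_ltM.
  apply: le_trans (slope_bd km0 kk2 (ltW y0) (ltW yp) pR) _.
  apply: ler_wpM2l; last by rewrite lerD2r.
  by apply: divr_ge0; [exact: ltW|rewrite mulr_ge0// ltW].
have h1 : Itg (lag k1) y z - 2 * (k1 - k2) * Itg (slope k2) y z <= Itg parabola_drag y z.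
  rewrite -ItgZ; last exact: itgb_slope.
  rewrite -ItgB; [|exact: itgb_lag|by apply: itgbZ; exact: itgb_slope].
  apply: le_Itg; [|exact: itgb_parabola|].
    by apply: itgbB; [exact: itgb_lag|apply: itgbZ; exact: itgb_slope].
  move=> r /andP[yr rz]; have r0 : 0 < r := lt_le_trans y0 yr.
  rewrite /parabola_drag -lag_threshold//.
  apply: le_trans (_ : lag k2 r <= _).
    by rewrite lerBlDr; exact: lag_envelope.
  by apply: lag_homo => //; apply: kmin; rewrite rz (le_trans ay yr).
have h2 : Itg (lag k1) z R - 2 * (k1 - k2) * Itg (slope k2) z R <= Itg (lag k2) z R.
  rewrite -ItgZ; last exact: itgb_slope.
  rewrite -ItgB; [|exact: itgb_lag|by apply: itgbZ; exact: itgb_slope].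
  apply: le_Itg; [|exact: itgb_lag|].
    by apply: itgbB; [exact: itgb_lag|apply: itgbZ; exact: itgb_slope].
  move=> r /andP[zr _]; have r0 : 0 < r := lt_le_trans z0 zr.
  by rewrite lerBlDr; exact: lag_envelope.
exact: dual_bound_combine k12 (dual_diff (ltW y0) yz zR k10 k20) h1 h2 h3.
Qed.

Lemma dual_bound_right x : a <= x -> x <= R -> exists2 r,
  a <= r <= x & dual_bound a (kap a) <= dual_bound x (kap r).
Proof.
have a0' := a0; have aR' := aR; move=> ax xR.
pose P y := [set r | a <= r <= y /\ forall t, a <= t <= y -> kap r <= kap t].
(* [kap (rm y)] is the minimum of [kap] on [a, y]. *)
pose rm y := xget a (P y).
have rmP y : a <= y -> P y (rm y).
  move=> ay; have cs := continuous_subspaceT (@continuous_threshold K q) (A := `[a, y]).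
  have [r] := EVT_min ay cs; rewrite in_itv/= => ry rmin.
  by apply: (@xgetPex _ a (P y)); exists r; split.
have aa : rm a = a.
  by have [/andP[h1 h2] _] := rmP a (lexx a); apply/eqP; rewrite eq_le h1 h2.
have [rx _] := rmP x ax; exists (rm x) => //.
have -> : kap a = kap (rm a) by rewrite aa.
have [km km0 kmP] : exists2 km, 0 < km &
    forall y, a <= y -> y <= R -> km <= kap (rm y).
  exists (a * h (- 3)); first by rewrite mulr_gt0// hN_gt0.
  move=> y ay yR; have [/andP[h1 h2] _] := rmP y ay.
  apply: threshold_ge => //; first by rewrite mulr_ge0//; lra.
  by apply: le_trans qR; rewrite ler_wpM2l//; lra.
apply: (@le_telescoping K a x (2 * (R / (4 * km))) (fun y => dual_bound y (kap (rm y)))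
  (fun y => - kap (rm y))) => // y z ay yz zx.
have az : a <= z by lra.
have zR : z <= R by lra.
have [/andP[ry1 ry2] rymin] := rmP y ay; have [/andP[rz1 rz2] rzmin] := rmP z az.
have ky := kmP y ay (le_trans yz zR); have kz := kmP z az zR.
have kzy : kap (rm z) <= kap (rm y) by apply: rzmin; apply/andP; split; lra.
(* Either the minimum is unchanged and only the endpoint moves, which is favourable since [kap] is
   at least the multiplier on [y, z]; or it drops, and is then attained beyond y. *)
have [eqk|ltk] := eqVneq (kap (rm z)) (kap (rm y)); last first.
  have {}ltk : kap (rm z) < kap (rm y) by rewrite lt_neqAle ltk.
  have yr : y < rm z.
    rewrite ltNge; apply/negP => rzy; have := rymin (rm z).
    by rewrite rz1 rzy => /(_ isT); rewrite leNgt ltk.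
  rewrite [X in _ <= X](_ : _ = 2 * (kap (rm y) - kap (rm z)) * (R / (4 * km) * (z - y))).
    exact: (dual_step_right ay yr rz2 zR km0 kz kzy erefl rzmin).
  by ring.
have k10 : 0 < kap (rm y) by lra.
rewrite eqk opprK [- kap (rm y) + _]addrC subrr mulr0 subr_le0 -subr_ge0.
rewrite dual_diff//; last by lra.
rewrite !subrr addr0 mulr0 mul0r addr0 subr_ge0.
apply: le_Itg; [exact: itgb_lag|exact: itgb_parabola|].
move=> r /andP[yr' rz']; have r0 : 0 < r by lra.
rewrite /parabola_drag -lag_threshold//; apply: lag_homo => //.
by rewrite -eqk; apply: rzmin; apply/andP; split; lra.
Qed.

Let parabola_le_lag y z k : 0 <= y -> 0 < k ->
  (forall r, y <= r <= z -> kap r <= k) ->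
  Itg parabola_drag y z <= Itg (lag k) y z.
Proof.
move=> y0 k0 kmax; apply: le_Itg; [exact: itgb_parabola|exact: itgb_lag|].
move=> r yrz; have /andP[yr _] := yrz.
have := le_trans y0 yr; rewrite le_eqVlt => /predU1P[<-|r0].
  by rewrite lag0// /parabola_drag mul0r.
rewrite /parabola_drag -lag_threshold//; apply: lag_homo => //.
- exact: threshold_gt0.
- exact: kmax.
Qed.

(** Mirror image of [dual_step_right], with [zeta R q p] >= M as p <= a. Here y may be 0, where the
    threshold vanishes, hence the separate positivity of p. *)
Let dual_step_left y z p km k1 k2 : 0 <= y -> y <= p -> p < z -> z <= a ->
  0 < p -> 0 < km -> km <= k1 -> 0 < k2 -> k2 <= k1 -> k1 = kap p ->
  Itg parabola_drag y z <= Itg (lag k1) y z ->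
  dual_bound z k2 - dual_bound y k1 <=
    2 * (k1 - k2) * (R / (4 * km) * (z - y)).
Proof.
have aR' := aR; move=> y0 yp pz za p0 km0 kk1 k20 k21 k1E h1.
have yz : y <= z by lra.
have zR : z <= R by lra.
have z0 : 0 < z by lra.
have k10 : 0 < k1 by lra.
have k12 : 0 <= 2 * (k1 - k2) by lra.
have pa : p <= a by lra.
have h3 : M <= Itg (slope k1) z R + R / (4 * km) * (z - y).
  apply: le_trans (zeta_gtM p0 pa) _.
  rewrite (zetaE R q p0) -k1E (Itg_chasles (itgb_slope p R k10) (ltW pz) zR) addrC.
  apply: lerD => //.
  apply: le_trans (slope_bd km0 kk1 (ltW p0) (ltW pz) zR) _.
  apply: ler_wpM2l; last by rewrite lerD2l lerN2.
  by apply: divr_ge0; [exact: ltW|rewrite mulr_ge0// ltW].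
have h2 : Itg (lag k2) z R <= Itg (lag k1) z R - 2 * (k1 - k2) * Itg (slope k1) z R.
  rewrite -ItgZ; last exact: itgb_slope.
  rewrite -ItgB; [|exact: itgb_lag|by apply: itgbZ; exact: itgb_slope].
  apply: le_Itg; [exact: itgb_lag| |].
    by apply: itgbB; [exact: itgb_lag|apply: itgbZ; exact: itgb_slope].
  move=> r /andP[zr _]; have r0 : 0 < r := lt_le_trans z0 zr.
  rewrite -mulNr -mulrN opprB; exact: lag_envelope.
have dd := dual_diff y0 yz zR k10 k20.
by rewrite dd; have := ler_wpM2l k12 h3; lra.
Qed.

Lemma dual_bound_left x : 0 <= x -> x <= a -> exists r,
  [/\ 0 < r, x <= r, r <= a & dual_bound a (kap a) <= dual_bound x (kap r)].
Proof.
have a0' := a0; have aR' := aR; move=> x0 xa.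
pose P y := [set r | y <= r <= a /\ forall t, y <= t <= a -> kap t <= kap r].
(* [kap (rm y)] is the maximum of [kap] on [y, a]. *)
pose rm y := xget a (P y).
have rmP y : y <= a -> P y (rm y).
  move=> ya; have cs := continuous_subspaceT (@continuous_threshold K q) (A := `[y, a]).
  have [r] := EVT_max ya cs; rewrite in_itv/= => ry rmax.
  by apply: (@xgetPex _ a (P y)); exists r; split.
have aa : rm a = a.
  by have [/andP[h1 h2] _] := rmP a (lexx a); apply/eqP; rewrite eq_le h1 h2.
have ka0 := threshold_gt0 q a0.
have kmP y : y <= a -> kap a <= kap (rm y).
  by move=> ya; have [_ H] := rmP y ya; apply: H; rewrite ya lexx.
have [/andP[rx1 rx2] _] := rmP x xa; exists (rm x); split => //.
  (* The maximum is at least [kap a] > 0 and [kap] vanishes at 0, so it is not attained there. *)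
  rewrite lt_neqAle (le_trans x0 rx1) andbT; apply/eqP => r0.
  by have := kmP x xa; rewrite -r0 [kap 0]/threshold mul0r; lra.
have -> : kap a = kap (rm a) by rewrite aa.
(* The telescoping runs upwards from x to a, along which the bound decreases; hence the sign. *)
rewrite -lerN2; pose km := kap a.
apply: (@le_telescoping K x a (2 * (R / (4 * km))) (fun y => - dual_bound y (kap (rm y)))
  (fun y => - kap (rm y))) => // y z xy yz za.
have y0 : 0 <= y by lra.
have ya : y <= a by lra.
have zR : z <= R by lra.
have [/andP[ry1 ry2] rymax] := rmP y ya; have [/andP[rz1 rz2] rzmax] := rmP z za.
have ky := kmP y ya; have kz := kmP z za.
have kzy : kap (rm z) <= kap (rm y) by apply: rymax; apply/andP; split; lra.
have k10 : 0 < kap (rm y) by lra.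
have k20 : 0 < kap (rm z) by lra.
have h1 : Itg parabola_drag y z <= Itg (lag (kap (rm y))) y z.
  apply: parabola_le_lag => // r /andP[yr rz].
  by apply: rymax; rewrite yr (le_trans rz za).
have [eqk|ltk] := eqVneq (kap (rm z)) (kap (rm y)).
  rewrite eqk subrr mulr0 opprK addrC subr_le0 -subr_le0 dual_diff//.
  by rewrite !subrr addr0 mulr0 mul0r addr0 subr_le0.
have {}ltk : kap (rm z) < kap (rm y) by rewrite lt_neqAle ltk.
have yr : rm y < z.
  rewrite ltNge; apply/negP => zry; have := rzmax (rm y).
  by rewrite ry2 zry => /(_ isT); rewrite leNgt ltk.
have r0 : 0 < rm y.
  rewrite lt_neqAle (le_trans y0 ry1) andbT; apply/eqP => r0.
  by move: k10; rewrite -r0 /threshold mul0r ltxx.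
rewrite [X in _ <= X](_ : _ = 2 * (kap (rm y) - kap (rm z)) * (R / (4 * km) * (z - y))).
  rewrite opprK addrC.
  exact: (dual_step_left y0 ry1 yr za r0 ka0 ky k20 kzy erefl h1).
by ring.
Qed.

End DualBound.

(** Passage to the limit y -> R for estimates that are available only below R, with an error O(R -
    y). *)
Lemma le_left_limit (K : realFieldType) (x R A B C : K) : x < R ->
  (forall y, x < y -> y < R -> A <= B + C * (R - y)) -> A <= B.
Proof.
move=> xR H; rewrite leNgt; apply/negP => BA.
have C0 : 0 < `|C| + 1 by rewrite ltr_wpDl.
pose d := Num.min ((R - x) / 2) ((A - B) / (2 * (`|C| + 1))).
have d0 : 0 < d by rewrite lt_min !divr_gt0// ?subr_gt0// mulr_gt0.
have d1 : d <= (R - x) / 2 by rewrite ge_min lexx.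
have d2 : d <= (A - B) / (2 * (`|C| + 1)) by rewrite ge_min lexx orbT.
have {}d2 : (`|C| + 1) * d <= (A - B) / 2.
  apply: le_trans (ler_wpM2l (ltW C0) d2) _.
  by rewrite le_eqVlt; apply/orP; left; apply/eqP; field; rewrite gt_eqF.
have := H (R - d); rewrite subKr.
have -> : x < R - d by lra.
have -> : R - d < R by lra.
move=> /(_ isT isT); have := ler_wpM2r (ltW d0) (ler_norm C); lra.
Qed.

(** * Weak duality for a profile and its equality case *)

Section ProfileBound.
Variables (K : realType) (R M q : K) (v : K -> K).
Hypotheses (R0 : 0 < R) (M0 : 0 < M) (q0 : 0 <= q) (qR : q * R <= 1).
Hypothesis pv : profiles R M q v.
Implicit Types (k r s x y z p : K).

Local Notation m := (profile_slope R q v).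
Local Notation pd := (profile_drag R q v).

Lemma profile_turn : exists x, [/\ 0 <= x, x <= R,
  forall r, 0 <= r -> r < x -> m r <= q * x &
  forall r, x < r -> r < R -> q * r < m r].
Proof.
pose S := [set r | r = 0 \/ (0 <= r < R /\ m r <= q * r)].
have S0 : S 0 by left.
have SR : ubound S R by move=> r [->|[/andP[_ /ltW]]]; [exact: ltW|].
have hs : has_sup S by split; [exists 0|exists R].
have ub := sup_upper_bound hs.
exists (sup S); split.
- exact: ub.
- by apply: ge_sup SR; exists 0.
- move=> r r0 rS.
  have e0 : 0 < sup S - r by lra.
  have [s Ss] := sup_adherent e0 hs; rewrite subKr => rs.
  have sS := ub _ Ss; case: Ss => [s0|[/andP[s0 sR] ms]]; first by lra.
  apply: le_trans (profile_slope_nd pv r0 (ltW rs) sR) _.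
  by apply: le_trans ms _; rewrite ler_wpM2l.
- move=> r Sr rR; rewrite ltNge; apply/negP => mr.
  suff /ub : S r by rewrite leNgt Sr.
  right; split => //; rewrite rR andbT; apply/ltW; apply: le_lt_trans Sr.
  exact: ub.
Qed.

Lemma profile_drop y z : 0 <= y -> y <= z -> z < R ->
  itgb (fun r => m r - q * r) y z /\
  v y - v z = Itg (fun r => m r - q * r) y z.
Proof.
move=> y0 yz zR; have [mi mE] := profile_Itg pv y0 yz zR.
have qi : itgb (fun r => q * r) y z.
  by apply: itgbZ; apply: itgb_nd.
split; first exact: itgbB.
rewrite ItgB// -mE.
have [||_ <-] := @mono_Itg K (fun r => q * r) (fun r => q / 2 * r ^+ 2) y z yz.
- by move=> s t _ st _; rewrite ler_wpM2l.
- move=> s t _ st _.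
  have -> : q / 2 * t ^+ 2 - q / 2 * s ^+ 2 = q * ((s + t) / 2 * (t - s)) by ring.
  have ts : 0 <= t - s by lra.
  have qts := mulr_ge0 q0 (mulr_ge0 ts ts).
  by apply/andP; split; lra.
by ring.
Qed.

Variable x : K.
Hypotheses (x0 : 0 <= x) (xR : x <= R).
Hypothesis mx : forall r, 0 <= r -> r < x -> m r <= q * x.
Hypothesis xm : forall r, x < r -> r < R -> q * r < m r.

Let left_bound : Itg (parabola_drag q) 0 x <= Itg pd 0 x /\
  (Itg pd 0 x <= Itg (parabola_drag q) 0 x -> forall r, 0 <= r -> r < x -> m r = 0).
Proof.
have R0' := R0; have x0' := x0; have xR' := xR.
have [x00|x1] := leP x 0.
  have -> : x = 0 by lra.
  by rewrite !Itgaa; split => // _ r r0 rx; exfalso; lra.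
apply: (@left_estimate K q x m q0 _ x1).
- by apply: le_trans qR; rewrite ler_wpM2l.
- by move=> r s r0 rs sx; apply: (profile_slope_nd pv) => //; lra.
- move=> r r0 rx; rewrite mx// andbT; apply: (profile_slope_ge0 pv) => //; lra.
Qed.

Let slack k r := pd r + 2 * k * (m r - q * r) - lag k r.

Let pd_pos r : x < r -> r < R -> pd r = r * drag (m r - q * r).
Proof. by move=> _ _; rewrite /profile_drag /drag -sqrrN opprB. Qed.

Let slack_ge0 k r : 0 < k -> x < r -> r < R -> 0 <= slack k r.
Proof.
move=> k0 xr rR; have r0 : 0 < r by exact: le_lt_trans x0 xr.
rewrite /slack pd_pos// subr_ge0; apply: lag_le => //.
by rewrite subr_ge0 ltW// xm.
Qed.

Let itgb_pd y z : 0 <= y -> z <= R -> itgb pd y z.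
Proof. by move=> y0 zR; exact: itgb_profile_drag pv _ _. Qed.

Let slack_Itg k y z : 0 < k -> x <= y -> y <= z -> z < R ->
  [/\ itgb (slack k) y z, 0 <= Itg (slack k) y z &
   Itg pd y z = Itg (lag k) y z - 2 * k * (v y - v z) + Itg (slack k) y z].
Proof.
move=> k0 xy yz zR; have y0 : 0 <= y := le_trans x0 xy.
have [di dE] := profile_drop y0 yz zR.
have pi : itgb pd y z by apply: itgb_pd => //; exact: ltW.
have li := itgb_lag y z k0.
have kdi : itgb (fun r => 2 * k * (m r - q * r)) y z by exact: itgbZ.
have si : itgb (slack k) y z by apply: itgbB => //; exact: itgbD.
split => //.
  apply: Itg_ge0_oo => // r /andP[yr rz].
  by apply: slack_ge0 => //; [exact: le_lt_trans xy yr|exact: lt_trans rz zR].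
have : Itg (slack k) y z = Itg pd y z + 2 * k * (v y - v z) - Itg (lag k) y z.
  rewrite /slack ItgB//; last exact: itgbD.
  by rewrite ItgD// ItgZ// -dE.
by move=> ->; ring.
Qed.

(** The gap is the excess left of x, plus the Lagrangian slack on [x, y], plus the complementary
    slackness term, all nonnegative, up to tails beyond y. Weak duality and its equality case are
    both read off from it. *)
Lemma profile_dual_identity k y : 0 < k -> x < y -> y < R ->
  Itg pd 0 R - dual_bound R M q x k =
  (Itg pd 0 x - Itg (parabola_drag q) 0 x) + Itg (slack k) x y
  + 2 * k * (M - (v x - v y)) + Itg pd y R - Itg (lag k) y R.
Proof.
move=> k0 xy yR; have y0 : 0 < y := le_lt_trans x0 xy.
have [_ _ E] := slack_Itg k0 (lexx x) (ltW xy) yR.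
rewrite /dual_bound (Itg_chasles (itgb_pd (lexx 0) (lexx R)) x0 xR).
rewrite (Itg_chasles (itgb_pd x0 (lexx R)) (ltW xy) (ltW yR)) E.
rewrite (Itg_chasles (itgb_lag x R k0) (ltW xy) (ltW yR)); ring.
Qed.

Let drop_le y : x < y -> y < R -> 0 <= M - (v x - v y).
Proof.
move=> xy yR; have y0 : 0 <= y := ltW (le_lt_trans x0 xy).
have /andP[_ vx] := profile_range pv x0 xR.
by have /andP[vy _] := profile_range pv y0 (ltW yR); lra.
Qed.

Let pd_tail y : x < y -> y < R -> 0 <= Itg pd y R.
Proof.
move=> xy yR; apply: Itg_ge0 => r /andP[yr _].
have r0 : 0 <= r := le_trans (ltW (le_lt_trans x0 xy)) yr.
by have /andP[] := profile_drag_ge0 R q v r0.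
Qed.

Let lag_tail k y : 0 < k -> x < y -> y < R -> Itg (lag k) y R <= R * (R - y).
Proof.
move=> k0 xy yR; apply: Itg_le_cst; [exact: ltW|exact: itgb_lag|].
move=> r /andP[yr rR]; have r0 : 0 < r := lt_le_trans (le_lt_trans x0 xy) yr.
exact: le_trans (lag_le_id k0 r0) rR.
Qed.

Lemma dual_bound_le k : 0 < k -> dual_bound R M q x k <= Itg pd 0 R.
Proof.
move=> k0; have [lb _] := left_bound.
move: (xR); rewrite le_eqVlt => /predU1P[xE|xltR].
  have -> : dual_bound R M q x k = Itg (parabola_drag q) 0 x - 2 * k * M.
    by rewrite /dual_bound xE Itgaa addr0.
  have -> : Itg pd 0 R = Itg pd 0 x by rewrite xE.
  have : 0 < 2 * k * M by rewrite !mulr_gt0.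
  lra.
apply: (@le_left_limit K x R _ _ R xltR) => y xy yR.
have := profile_dual_identity k0 xy yR.
have [_ s0 _] := slack_Itg k0 (lexx x) (ltW xy) yR.
have := pd_tail xy yR; have := lag_tail k0 xy yR.
have := drop_le xy yR => d0.
have : 0 <= 2 * k * (M - (v x - v y)) by rewrite mulr_ge0// mulr_ge0// ltW.
lra.
Qed.

(** Each nonnegative term of [profile_dual_identity] is at most R (R - y), and letting y tend to R
    makes all of them vanish: no excess left of x, descent at the rate [slope k] almost everywhere,
    and a total drop of M. *)
Lemma dual_bound_eq k : 0 < k -> Itg pd 0 R <= dual_bound R M q x k ->
  [/\ x < R, forall r, 0 <= r -> r < x -> m r = 0,
      Itg (slope k) x R = M,
      forall y, x <= y -> y < R -> v y = M - Itg (slope k) x y & v R = 0].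
Proof.
move=> k0 Jle; have [lb lbeq] := left_bound.
have xltR : x < R.
  rewrite lt_neqAle xR andbT; apply/eqP => xE.
  move: Jle; have -> : dual_bound R M q x k = Itg (parabola_drag q) 0 x - 2 * k * M.
    by rewrite /dual_bound xE Itgaa addr0.
  have -> : Itg pd 0 R = Itg pd 0 x by rewrite xE.
  have : 0 < 2 * k * M by rewrite !mulr_gt0.
  lra.
have key y : x < y -> y < R -> [/\ Itg pd 0 x - Itg (parabola_drag q) 0 x <= R * (R - y),
    Itg (slack k) x y <= R * (R - y) & 2 * k * (M - (v x - v y)) <= R * (R - y)].
  move=> xy yR.
  have := profile_dual_identity k0 xy yR.
  have [_ s0 _] := slack_Itg k0 (lexx x) (ltW xy) yR.
  have := pd_tail xy yR; have := lag_tail k0 xy yR.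
  have := drop_le xy yR => d0.
  have d1 : 0 <= 2 * k * (M - (v x - v y)) by rewrite mulr_ge0// mulr_ge0// ltW.
  by split; lra.
have slack0 y : x < y -> y < R -> Itg (slack k) x y = 0.
  move=> xy yR; have [_ s0 _] := slack_Itg k0 (lexx x) (ltW xy) yR.
  apply/eqP; rewrite eq_le s0 andbT.
  apply: (@le_left_limit K y R _ _ R yR) => z yz zR; rewrite add0r.
  have [_ + _] := key z (lt_trans xy yz) zR; apply: le_trans.
  have [si _ _] := slack_Itg k0 (lexx x) (ltW (lt_trans xy yz)) zR.
  rewrite (Itg_chasles si (ltW xy) (ltW yz)) lerDl.
  by have [] := slack_Itg k0 (ltW xy) (ltW yz) zR.
have vE y : x <= y -> y < R -> v x - v y = Itg (slope k) x y.
  rewrite le_eqVlt => /predU1P[<- _|xy yR]; first by rewrite subrr Itgaa.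
  have [di ->] := profile_drop x0 (ltW xy) yR.
  apply: eq_Itg_ae => //; first exact: itgb_slope.
  have [si _ _] := slack_Itg k0 (lexx x) (ltW xy) yR.
  have sp r : x < r < y -> 0 <= slack k r.
    by move=> /andP[xr ry]; apply: slack_ge0 => //; exact: lt_trans ry yR.
  have := Itg_eq0_ae_oo si sp (slack0 y xy yR).
  apply: filterS; first exact: (ae_filter_ringOfSetsType (@lebesgue_measure K)).
  move=> r sr xry; have /andP[xr ry] := xry.
  have rR := lt_trans ry yR; have r0 := le_lt_trans x0 xr.
  apply: lag_eq k0 r0 _ _; first by rewrite subr_gt0 xm.
  by move: (sr xry); rewrite /slack pd_pos// => /eqP; rewrite subr_eq0 => /eqP.
have /andP[vx0 vxM] := profile_range pv x0 xR.
have vxE : v x = M.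
  apply/eqP; rewrite eq_le vxM.
  apply: (@le_left_limit K x R _ _ (R / (2 * k)) xltR) => y xy yR.
  have [_ _] := key y xy yR.
  have /andP[vy _] := profile_range pv (ltW (le_lt_trans x0 xy)) (ltW yR).
  have k2 : 0 < 2 * k by rewrite mulr_gt0.
  rewrite mulrC -ler_pdivlMr// => H.
  have -> : R / (2 * k) * (R - y) = R * (R - y) / (2 * k) by ring.
  by lra.
have vyE y : x <= y -> y < R -> v y = M - Itg (slope k) x y.
  by move=> xy yR; rewrite -vE// vxE; ring.
have slope_tail y : x < y -> y < R -> 0 <= Itg (slope k) y R <= R / (4 * k) * (R - y).
  move=> xy yR; apply/andP; split; first by apply: Itg_ge0 => r _; exact: slope_ge0.
  apply: Itg_le_cst; [exact: ltW|exact: itgb_slope|].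
  move=> r /andP[yr rR]; have r0 : 0 < r := lt_le_trans (le_lt_trans x0 xy) yr.
  apply: le_trans (slope_ub k0 r0) _; rewrite ler_wpM2r// invr_ge0 mulr_ge0// ltW//.
have IE y : x < y -> y < R -> Itg (slope k) x R = (M - v y) + Itg (slope k) y R.
  move=> xy yR; rewrite (Itg_chasles (itgb_slope x R k0) (ltW xy) (ltW yR)).
  by rewrite vyE//; [ring|exact: ltW].
have IM : Itg (slope k) x R = M.
  apply/eqP; rewrite eq_le; apply/andP; split.
    apply: (@le_left_limit K x R _ _ (R / (4 * k)) xltR) => y xy yR.
    rewrite (IE y xy yR); have /andP[_] := slope_tail y xy yR.
    have /andP[vy _] := profile_range pv (ltW (le_lt_trans x0 xy)) (ltW yR); lra.
  apply: (@le_left_limit K x R _ _ (R / (2 * k)) xltR) => y xy yR.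
  rewrite (IE y xy yR); have /andP[s0 _] := slope_tail y xy yR.
  have [_ _] := key y xy yR.
  have k2 : 0 < 2 * k by rewrite mulr_gt0.
  rewrite mulrC -ler_pdivlMr// vxE => H.
  have -> : R / (2 * k) * (R - y) = R * (R - y) / (2 * k) by ring.
  by lra.
split => //.
  apply: lbeq; rewrite -subr_le0.
  apply: (@le_left_limit K x R _ _ R xltR) => y xy yR; rewrite add0r.
  by have [] := key y xy yR.
have /andP[vR0 _] := profile_range pv (ltW R0) (lexx R).
apply/eqP; rewrite eq_le vR0 andbT.
(* A concave profile may jump down at R, so [v R] is bounded from below R by monotonicity of v - q
   r^2 / 2, not by continuity. *)
apply: (@le_left_limit K x R _ _ (R / (4 * k) + q * R) xltR) => y xy yR.
have y0 : 0 < y := le_lt_trans x0 xy.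
have := profile_anti pv (ltW y0) (ltW yR) (lexx R).
have := IE y xy yR; rewrite IM; have /andP[_] := slope_tail y xy yR.
have : q / 2 * (R ^+ 2 - y ^+ 2) <= q * R * (R - y).
  have -> : q / 2 * (R ^+ 2 - y ^+ 2) = q * ((R + y) / 2) * (R - y) by ring.
  by rewrite ler_wpM2r ?ler_wpM2l//; lra.
lra.
Qed.

End ProfileBound.

Lemma concave_supergradient (K : realType) (a b : K) (f : K -> K) :
  (forall z, a <= z <= b -> exists c, forall s, a <= s <= b -> f s <= f z + c * (s - z)) ->
  concave_function `[a, b] f.
Proof.
move=> fc t x y; rewrite !inE/= !in_itv/= => /andP[ax xb] /andP[ay yb].
set z := (X in _ <= f X); have t0 : 0 <= t%:num by []; have t1 : t%:num <= 1 by [].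
have zE : z = t%:num * x + (1 - t%:num) * y by [].
have zab : a <= z <= b by rewrite zE; apply/andP; split; nra.
have [c fz] := fc z zab.
have fx : f x <= f z + c * (x - z) by apply: fz; rewrite ax.
have fy : f y <= f z + c * (y - z) by apply: fz; rewrite ay.
rewrite convRE /= /unstable.onem.
have t1' : 0 <= 1 - t%:num by lra.
apply: le_trans (lerD (ler_wpM2l t0 fx) (ler_wpM2l t1' fy)) _.
have -> : t%:num * (f z + c * (x - z)) + (1 - t%:num) * (f z + c * (y - z)) =
    f z + c * (t%:num * x + (1 - t%:num) * y - z) by ring.
by rewrite -zE subrr mulr0 addr0.
Qed.

(** * The optimal profile is admissible and attains the dual bound *)

Section OptimalProfile.
Variables (K : realType) (R M q a : K).
Hypotheses (q0 : 0 <= q) (M_large : q * R ^+ 2 <= 2 * M).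
Hypotheses (a0 : 0 < a) (aR : a < R) (aM : zeta R q a = M).
Implicit Types (r s x y z : K).

Local Notation u := (optimal_profile R M q a).
Local Notation k := (threshold q a).

Let k0 : 0 < k. Proof. exact: threshold_gt0. Qed.
Let k4 : 4 * k <= a. Proof. exact: threshold_le4. Qed.

Let IM : Itg (slope k) a R = M. Proof. by rewrite -zetaE. Qed.

Lemma optimal_profile_left r : r <= a -> u r = q / 2 * (r ^+ 2 - a ^+ 2) + M.
Proof. by rewrite /optimal_profile => ->. Qed.

Lemma optimal_profile_right r : a <= r -> u r = Itg (slope k) r R.
Proof.
rewrite le_eqVlt => /predU1P[<-|ar].
  by rewrite optimal_profile_left// subrr mulr0 add0r IM.
rewrite /optimal_profile leNgt ar/=; apply: Itg_slope_threshold => //.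
exact: ltW.
Qed.

Let slope_nd' x y : x <= y -> slope k x <= slope k y.
Proof. exact: slope_nd. Qed.

Lemma optimal_profile_in : profiles R M q u.
Proof.
have a0' := a0; have aR' := aR; have k0' := k0; have q0' := q0; have ML := M_large.
pose w r := u r - q / 2 * r ^+ 2.
have wl r : r <= a -> w r = M - q / 2 * a ^+ 2.
  by move=> ra; rewrite /w optimal_profile_left//; ring.
have wr r : a <= r -> w r = Itg (slope k) r R - q / 2 * r ^+ 2.
  by move=> ra; rewrite /w optimal_profile_right.
have drop y z : a <= y -> y <= z -> z <= R ->
    (slope k y + q * y) * (z - y) <= w y - w z <= (slope k z + q * z) * (z - y).
  move=> ay yz zR; rewrite !wr//; last exact: le_trans ay yz.
  rewrite (Itg_chasles (itgb_slope y R k0) yz zR).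
  have h1 : slope k y * (z - y) <= Itg (slope k) y z.
    by apply: Itg_ge_cst => //; [exact: itgb_slope|move=> s /andP[ys _]; exact: slope_nd'].
  have h2 : Itg (slope k) y z <= slope k z * (z - y).
    by apply: Itg_le_cst => //; [exact: itgb_slope|move=> s /andP[_ sz]; exact: slope_nd'].
  have zy : 0 <= z - y by lra.
  have := mulr_ge0 q0 (mulr_ge0 zy zy).
  by move=> h3; apply/andP; split; lra.
have anti y z : 0 <= y -> y <= z -> z <= R -> w z <= w y.
  move=> y0 yz zR.
  have wdec x1 x2 : a <= x1 -> x1 <= x2 -> x2 <= R -> w x2 <= w x1.
    move=> ax xx xR; have /andP[+ _] := drop x1 x2 ax xx xR.
    have : 0 <= (slope k x1 + q * x1) * (x2 - x1).
      apply: mulr_ge0; last by lra.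
      by apply: addr_ge0; [exact: slope_ge0|apply: mulr_ge0 => //; lra].
    lra.
  have [ay|/ltW ya] := leP a y; first exact: wdec.
  have [az|/ltW za] := leP a z; last by rewrite !wl.
  by rewrite (wl y ya) -(wl a (lexx a)); apply: wdec.
split.
- move=> r; rewrite !in_itv/= => /andP[r0 rR].
  have [ra|/ltW ar] := leP r a.
    rewrite optimal_profile_left//.
    (* Nonnegativity comes down to q a^2 / 2 <= M, where [M_large] enters. *)
    have r2 : r ^+ 2 <= a ^+ 2 by nra.
    have a2 : a ^+ 2 <= R ^+ 2 by nra.
    have := ler_wpM2l q0 r2; have := ler_wpM2l q0 a2.
    have := mulr_ge0 q0 (sqr_ge0 r) => *; apply/andP; split; lra.
  rewrite optimal_profile_right//; apply/andP; split.
    by apply: Itg_ge0 => s _; exact: slope_ge0.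
  rewrite -IM (Itg_chasles (itgb_slope a R k0) ar rR) lerDr.
  by apply: Itg_ge0 => s _; exact: slope_ge0.
- move=> y z; rewrite !in_itv/= => /andP[y0 _] /andP[_ zR] yz; exact: anti.
(* Up to a the function w is constant and maximal, with supergradient 0; beyond a the two-sided
   bound [drop] provides one. *)
- apply: concave_supergradient => z /andP[z0 zR]; rewrite -/(w z).
  have [za|az] := leP z a.
    exists 0 => s /andP[s0 sR]; rewrite -/(w s) mul0r addr0 (wl z za).
    have [sa|/ltW as'] := leP s a; first by rewrite wl.
    by rewrite -(wl a (lexx a)); apply: anti => //; exact: ltW.
  have c0 : 0 <= slope k z + q * z.
    by apply: addr_ge0; [exact: slope_ge0|apply: mulr_ge0].
  exists (- (slope k z + q * z)) => s /andP[s0 sR]; rewrite -/(w s).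
  have main t : a <= t -> t <= R -> w t <= w z + - (slope k z + q * z) * (t - z).
    move=> at' tR; have [tz|/ltW zt] := leP t z.
      by have /andP[_] := drop t z at' tz zR; lra.
    by have /andP[+ _] := drop z t (ltW az) zt tR; lra.
  have [as'|/ltW sa] := leP a s; first exact: main.
  rewrite (wl s sa) -(wl a (lexx a)).
  apply: le_trans (main a (lexx a) (ltW aR)) _.
  by have := ler_wpM2l c0 sa; lra.
Qed.

(** The jump of the slope sits at r = 4 k <= a; beyond it elasticity gives the Lipschitz constant 1
    / (4 k). *)
Let slope_cont r : a < r -> {for r, continuous (slope k)}.
Proof.
move=> ar; have a0' := a0; have k0' := k0; have k4' := k4.
have lip y z : a <= y -> y <= z -> slope k z - slope k y <= (z - y) / (4 * k).
  move=> ay yz; have y0 : 0 < y by lra.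
  have z0 : 0 < z by lra.
  have k4y : 4 * k <= y by lra.
  have kk : k * y <= k * z by rewrite ler_pM2l.
  have := slope_elastic k0 k0 z0 y0 k4y kk.
  have := slope_ub k0 y0; rewrite !ler_pdivlMr; try lra.
  move=> ub el.
  have {}el : slope k z * y <= slope k y * z.
    by rewrite -(ler_pM2l k0); lra.
  rewrite -(ler_pM2l y0).
  have zy : 0 <= z - y by lra.
  have := ler_wpM2r zy ub; have := ler_wpM2r (ltW k0) el; lra.
apply/cvgrPdist_le => e e0.
have ek : 0 < e * (4 * k) by rewrite mulr_gt0// mulr_gt0.
have /cvgrPdist_le/(_ _ ek) E : (fun t : K => t) t @[t --> r] --> r by exact: cvg_id.
near=> t.
have at' : a < t by near: t; exact: lt_nbhsr.
have tr : `|r - t| <= e * (4 * k) by near: t.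
have k4p : 0 < 4 * k by lra.
have [rt|/ltW tr'] := leP r t.
  rewrite ler0_norm ?subr_le0 ?slope_nd'// opprB.
  apply: le_trans (lip r t (ltW ar) rt) _; rewrite ler_pdivrMr//.
  by apply: le_trans tr; rewrite -opprB ler_normr lexx orbT.
rewrite ger0_norm ?subr_ge0 ?slope_nd'//.
apply: le_trans (lip t r (ltW at') tr') _; rewrite ler_pdivrMr//.
by apply: le_trans tr; exact: ler_norm.
Unshelve. all: by end_near. Qed.

Let derive_left r : 0 < r -> r < a -> derive1 u r = q * r.
Proof.
move=> r0 ra.
have nu : \near r, q / 2 * (r ^+ 2 - a ^+ 2) + M = u r.
  by near=> t; rewrite optimal_profile_left//; apply/ltW; near: t; exact: lt_nbhsl.
have isu : is_derive r 1 u (q * r).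
  apply: near_eq_is_derive nu _.
  by apply: is_derive_eq; rewrite /GRing.scale/= !mulr1; field.
by rewrite derive1E derive_val.
Unshelve. all: by end_near. Qed.

Let derive_right r : a < r -> r < R -> derive1 u r = - slope k r.
Proof.
move=> ar rR.
have [dF F'] := @continuous_FTC1_closed K (slope k) a r R rR (itgb_slope a R k0) ar
  (slope_cont ar).
have nu : \near r, M - Itg (slope k) a r = u r.
  near=> t.
  have at' : a <= t by apply/ltW; near: t; exact: lt_nbhsr.
  have tR : t <= R by apply/ltW; near: t; exact: lt_nbhsl.
  rewrite optimal_profile_right// -IM (Itg_chasles (itgb_slope a R k0) at' tR).
  by ring.
have isF : is_derive r 1 (fun x => Itg (slope k) a x) (slope k r).
  by apply: DeriveDef; [exact: dF|rewrite -derive1E; exact: F'].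
have isu : is_derive r 1 u (- slope k r).
  apply: near_eq_is_derive nu _.
  have : is_derive r 1 (fun x => M - Itg (slope k) a x) (0 - slope k r).
    exact: is_deriveB.
  by rewrite sub0r.
by rewrite derive1E derive_val.
Unshelve. all: by end_near. Qed.

(** No duality gap: on [a, R] the slope realises [lag] pointwise and its integral is exactly M, so
    the terms in 2 k cancel. *)
Lemma resistance_optimal_profile :
  resistance R u = (dual_bound R M q a k)%:E.
Proof.
have R0 : 0 < R by exact: lt_trans a0 aR.
pose f r := r * drag (derive1 u r).
have m1 : measurable_fun `]0, a[ (derive1 u).
  apply: (eq_measurable_fun (fun r => q * r)); last exact: measurable_funM.
  by move=> r; rewrite inE/= in_itv/= => /andP[r0 ra]; rewrite derive_left.
have m2 : measurable_fun `]a, R[ (derive1 u).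
  apply: (eq_measurable_fun (fun r => - slope k r)).
    by move=> r; rewrite inE/= in_itv/= => /andP[ar rR]; rewrite derive_right.
  by apply: measurableT_comp => //; apply: nondecreasing_measurable.
have m12 : measurable_fun `]0, R[ (derive1 u).
  rewrite (@itv_bndbnd_setU _ _ (BRight 0) (BRight a) (BLeft R)) ?bnd_simp ?(ltW a0)//.
  by apply/measurable_funU => //; split => //; exact: measurable_fun_itv_oc m1.
have fi := itgb_drag m12.
have -> : resistance R u = (Itg f 0 R)%:E.
  by rewrite /resistance /Itg /Rintegral fineK//; exact: integrable_fin_num.
congr EFin; rewrite (Itg_chasles fi (ltW a0) (ltW aR)).
have sd : itgb (fun r => r * drag (slope k r)) a R.
  by apply: itgb_drag; apply: nondecreasing_measurable.
rewrite (@eq_Itg_oo K _ (parabola_drag q) 0 a (itgb_drag m1) (itgb_parabola _ _ _)); last first.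
  by move=> r /andP[r0 ra]; rewrite derive_left.
rewrite (@eq_Itg_oo K _ (fun r => r * drag (slope k r)) a R (itgb_drag m2) sd); last first.
  by move=> r /andP[ar rR]; rewrite derive_right// /drag sqrrN.
rewrite /dual_bound /lag ItgD//; last by apply: itgbZ; exact: itgb_slope.
by rewrite ItgZ ?IM; [ring|exact: itgb_slope].
Qed.

End OptimalProfile.

(** * Optimality and uniqueness *)

Section Optimality.
Variables (K : realType) (R M q a : K).
Hypotheses (R0 : 0 < R) (M0 : 0 < M) (q0 : 0 <= q) (qR : q * R <= 1).
Hypotheses (a0 : 0 < a) (aR : a < R) (aM : zeta R q a = M).
Implicit Types (v : K -> K) (x r : K).

Local Notation kap := (threshold q).

(** That r lies between a and x is what uniqueness needs in order to conclude x = a. *)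
Let dual_bound_between x : 0 <= x -> x <= R -> exists r,
  [/\ 0 < r, (a <= r <= x) || (x <= r <= a) &
      dual_bound R M q a (kap a) <= dual_bound R M q x (kap r)].
Proof.
move=> x0 xR; have [ax|/ltW xa] := leP a x.
  have [r rx H] := dual_bound_right q0 qR a0 aR aM ax xR; exists r; split => //.
    by case/andP: rx => ar _; exact: lt_le_trans a0 ar.
  by rewrite rx.
have [r [r0 xr ra H]] := dual_bound_left q0 qR a0 aR aM x0 xa.
by exists r; split => //; rewrite xr ra orbT.
Qed.

Lemma resistance_lower_bound v : profiles R M q v ->
  ((dual_bound R M q a (kap a))%:E <= resistance R v)%E.
Proof.
move=> pv; have [x [x0 xR mx xm]] := profile_turn R0 q0 pv.
have [r [r0 _ H]] := dual_bound_between x0 xR.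
apply: le_trans (resistance_ge R0 pv); rewrite lee_fin.
apply: le_trans H _.
exact: (dual_bound_le R0 M0 q0 qR pv x0 xR mx xm (threshold_gt0 q r0)).
Qed.

Lemma minimizer_unique v : profiles R M q v ->
  (resistance R v <= (dual_bound R M q a (kap a))%:E)%E ->
  forall r, 0 <= r -> r <= R -> v r = optimal_profile R M q a r.
Proof.
move=> pv Jv; have [x [x0 xR mx xm]] := profile_turn R0 q0 pv.
have [p [p0 pax H]] := dual_bound_between x0 xR.
have kp0 := threshold_gt0 q p0.
have Jle : Itg (profile_drag R q v) 0 R <= dual_bound R M q x (kap p).
  apply: le_trans H; rewrite -lee_fin; apply: le_trans Jv.
  exact: resistance_ge R0 pv.
have [xltR m0 IM vE vR] := dual_bound_eq R0 M0 q0 qR pv x0 xR mx xm kp0 Jle.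
have zetaM : zeta R q p = M -> p = a.
  move=> pM; have pR : p <= R.
    by case/orP: pax => /andP[_ pR]; [exact: le_trans pR xR|exact: le_trans pR (ltW aR)].
  exact: (zeta_unique q0 qR p0 pR a0 (ltW aR) pM aM).
have slope0 y z : 0 <= Itg (slope (kap p)) y z.
  by apply: Itg_ge0 => s _; exact: slope_ge0.
have xa : x = a.
  case/orP: pax => /andP[h1 h2].
    (* Case a <= p <= x: [zeta R q p] is at most M since p >= a, and at least M since [p, R]
       contains [x, R]. Then x = p, because the slope is at least 1 on [p, x]. *)
    have pM : p = a.
      apply: zetaM; apply/eqP; rewrite eq_le; apply/andP; split.
        have [<-|ne] := eqVneq a p; first by rewrite aM.
        have ap : a < p by rewrite lt_neqAle ne.
        by rewrite -aM; apply/ltW/zeta_decr => //; exact: le_trans h2 xR.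
      rewrite zetaE// -IM (Itg_chasles (itgb_slope p R kp0) h2 xR).
      by rewrite lerDr.
    have := aM; rewrite zetaE// -pM (Itg_chasles (itgb_slope p R kp0) h2 xR) IM.
    have : 1 * (x - p) <= Itg (slope (kap p)) p x.
      apply: Itg_ge_cst => //; first exact: itgb_slope.
      move=> s /andP[ps _]; have [_ _ g1] := gammaP q p.
      by apply: le_trans g1 _; rewrite -slope_threshold//; exact: slope_nd.
    by move: h2; rewrite pM; move: (Itg _ _ x) => I; lra.
  (* Case x <= p <= a: likewise p = a. The slope may vanish on part of [x, a], so x < a is excluded
     differently: v would not drop over [x, a], although its slope is negative beyond x. *)
  have pR : p <= R := le_trans h2 (ltW aR).
  have pM : p = a.
    apply: zetaM; apply/eqP; rewrite eq_le; apply/andP; split.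
      rewrite zetaE// -IM (Itg_chasles (itgb_slope x R kp0) h1 pR).
      by rewrite lerDr.
    have [->|ne] := eqVneq p a; first by rewrite aM.
    have pa : p < a by rewrite lt_neqAle ne.
    by rewrite -aM; apply/ltW/zeta_decr => //; exact: ltW.
  rewrite pM in h1; move: h1; rewrite le_eqVlt => /predU1P[//|xa].
  exfalso; have va := vE a (ltW xa) aR.
  have vx := vE x (lexx x) xltR; rewrite Itgaa in vx.
  have I0 : Itg (slope (kap p)) x a = 0.
    have := IM; rewrite (Itg_chasles (itgb_slope x R kp0) (ltW xa) (ltW aR)).
    have := aM; rewrite zetaE// pM; move: (Itg _ x a) (Itg _ a R) => I J.
    by lra.
  have [di dE] := profile_drop q0 pv x0 (ltW xa) aR.
  have dI0 : Itg (fun s => profile_slope R q v s - q * s) x a = 0 by rewrite -dE; lra.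
  have dp s : x < s < a -> 0 < profile_slope R q v s - q * s.
    by move=> /andP[xs sa]; rewrite subr_gt0 xm//; exact: lt_trans sa aR.
  have [s [xsa ds]] := ae_exists_itv xa (Itg_eq0_ae_oo di (fun s h => ltW (dp s h)) dI0).
  by have := dp s xsa; rewrite ds// ltxx.
have pa : p = a.
  by case/orP: pax; rewrite xa => /andP[h1 h2]; apply/eqP; rewrite eq_le h1 h2.
rewrite xa pa in m0 IM vE.
move=> r r0 rR; have [ar|ra] := leP a r.
  rewrite (optimal_profile_right a0 aM ar).
  move: rR; rewrite le_eqVlt => /predU1P[->|rR]; first by rewrite Itgaa.
  rewrite vE// -IM (Itg_chasles (itgb_slope a R _) ar (ltW rR)).
    by rewrite addrAC subrr add0r.
  exact: threshold_gt0.
rewrite (optimal_profile_left R M q (ltW ra)).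
have [mi mE] := profile_Itg pv r0 (ltW ra) aR.
have : Itg (profile_slope R q v) r a = 0.
  rewrite (@eq_Itg_oo K _ (fun=> 0) r a mi).
  - by rewrite (Itg_cst 0 (ltW ra)) mul0r.
  - exact: itgb_cst.
  - by move=> s /andP[rs sa]; apply: m0 => //; exact: le_trans r0 (ltW rs).
rewrite -mE (vE a (lexx a) aR) Itgaa; lra.
Qed.

End Optimality.

Theorem theorem2p2 (K : realType) (R M q : K)
  (R_gt0 : 0 < R) (M_gt0 : 0 < M) (qR_ge0 : 0 <= q * R) (qR_le1 : q * R <= 1)
  (M_large : q * R ^+ 2 <= 2 * M) :
  exists aM : K,
    unique (fun a => (a \in `]0, R[) /\ phi R a = M) aM /\
    exists astar : K,
      unique (fun a => (a \in `[aM, R[) /\ zeta R q a = M) astar /\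
      is_minimizer R M q (optimal_profile R M q astar) /\
      forall u : K -> K, is_minimizer R M q u ->
        {in `[0, R], forall r, u r = optimal_profile R M q astar r}.
Proof.
have q0 : 0 <= q by rewrite -(pmulr_lge0 _ R_gt0).
have z0R : 0 * R <= 1 by rewrite mul0r.
have [c] := zeta0_large R_gt0 M_gt0; rewrite in_itv/= => /andP[c0 cR] Mc.
have [aM] := zeta_exists (lexx 0) z0R c0 (ltW cR) M_gt0 Mc.
rewrite in_itv/= => /andP[caM aMR] aME.
have aM0 : 0 < aM := lt_le_trans c0 caM.
exists aM; split.
  split; first by rewrite in_itv/= aM0 aMR phiE.
  move=> b; rewrite in_itv/= => -[/andP[b0 bR]]; rewrite phiE// => bE.
  exact: (zeta_unique (lexx 0) z0R aM0 (ltW aMR) b0 (ltW bR) aME bE).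
have MaM : M <= zeta R q aM by rewrite -{1}aME; exact: zeta0_le (ltW aMR).
have [a] := zeta_exists q0 qR_le1 aM0 (ltW aMR) M_gt0 MaM.
rewrite in_itv/= => /andP[aMa aR] aE.
have a0 : 0 < a := lt_le_trans aM0 aMa.
exists a; split.
  split; first by rewrite in_itv/= aMa aR.
  move=> b; rewrite in_itv/= => -[/andP[aMb bR] bE].
  exact: (zeta_unique q0 qR_le1 a0 (ltW aR) (lt_le_trans aM0 aMb) (ltW bR) aE bE).
have low := resistance_lower_bound R_gt0 M_gt0 q0 qR_le1 a0 aR aE.
have resE := resistance_optimal_profile a0 aR aE.
split.
  split; first exact: optimal_profile_in.
  by move=> v pv; rewrite resE; exact: low.
move=> u [pu umin] r; rewrite in_itv/= => /andP[r0 rR].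
apply: (minimizer_unique R_gt0 M_gt0 q0 qR_le1 a0 aR aE pu) => //.
by rewrite -resE; apply: umin; exact: optimal_profile_in.
Qed.
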